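(* Any cluster algebra $\mathcal{A}$ of finite type (over a semifield $\mathbb{P}$, of rank $n$) is strongly isomorphic to a cluster algebra $\mathcal{A}(B_\circ,\mathbf{p}_\circ)$, where $B_\circ=(b_{ij})$ is a sign-skew-symmetric integer matrix whose Cartan counterpart $A(B_\circ)$ is a Cartan matrix of finite type and which satisfies $b_{ij}b_{ik}\ge0$ for all $i,j,k$, and $\mathbf{p}_\circ$ is a $2n$-tuple of elements of $\mathbb{P}$ satisfying the normalization conditions.
   Context: Semifields. A semifield $(\mathbb{P},\oplus,\cdot)$ is an abelian multiplicative group with a commutative, associative operation $\oplus$ over which multiplication distributes. Its multiplicative group is torsion-free, so the group ring $\mathbb{Z}\mathbb{P}$ is a domain. Seeds. Fix $\mathbb{P}$ and a rank $n$. The ambient field $\mathcal{F}$ is isomorphic to the field of rational functions in $n$ independent variables with coefficients in $\mathbb{Z}\mathbb{P}$. A seed in $\mathcal{F}$ is a triple $\Sigma=(\mathbf{x},\mathbf{p},B)$ where: $\mathbf{x}\subset\mathcal{F}$ is an $n$-element transcendence basis over the fraction field of $\mathbb{Z}\mathbb{P}$; $\mathbf{p}=(p_x^{\pm})_{x\in\mathbf{x}}$ is a $2n$-tuple of elements of $\mathbb{P}$ satisfying the normalization condition $p_x^+\oplus p_x^-=1$ for all $x$; $B=(b_{xy})_{x,y\in\mathbf{x}}$ is an integer matrix that is sign-skew-symmetric, i.e. for all $x,y$ either $b_{xy}=b_{yx}=0$ or $b_{xy}b_{yx}<0$. Mutations. The matrix mutation in direction $k$ sends $B=(b_{ij})$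 to $B'=(b'_{ij})$ with $b'_{ij}=-b_{ij}$ if $i=k$ or $j=k$, and $b'_{ij}=b_{ij}+\frac{|b_{ik}|b_{kj}+b_{ik}|b_{kj}|}{2}$ otherwise. For a seed $\Sigma$ and $z\in\mathbf{x}$ define $\overline\Sigma=(\overline{\mathbf{x}},\overline{\mathbf{p}},\overline B)$: $\overline{\mathbf{x}}=\mathbf{x}-\{z\}\cup\{\overline z\}$ with $\overline z$ given by the exchange relation $z\overline z=p_z^+\prod_{b_{xz}>0}x^{b_{xz}}+p_z^-\prod_{b_{xz}<0}x^{-b_{xz}}$; $\overline{\mathbf{p}}$ is determined by normalization $\overline p_x^+\oplus\overline p_x^-=1$ and $\overline p_x^+/\overline p_x^-=p_z^-/p_z^+$ if $x=\overline z$, $=(p_z^+)^{b_{zx}}p_x^+/p_x^-$ if $b_{zx}\ge0$, $=(p_z^-)^{b_{zx}}p_x^+/p_x^-$ if $b_{zx}\le0$; $\overline B$ is the matrix mutation of $B$ in direction $z$, with the index $z$ relabeled $\overline z$. If $\overline\Sigma$ is a seed, $\Sigma$ admits a mutation in direction $z$. Cluster algebras. Let $\mathcal{S}$ be a set of seeds in $\mathcal{F}$ such that each seed in $\mathcal S$ admits mutations in all $n$ directions, with results in $\mathcal{S}$, and any two seeds in $\mathcal{S}$ are related by a sequence of mutations. The sets $\mathbf{x}$ are clusters, their elements cluster variables; $\mathcal{X}$ is the set of all cluster variables and $\mathcal{P}$ the set of all $p_x^\pm$ over all seeds in $\mathcal{S}$. The cluster algebra $\mathcal{A}(\mathcal{S})$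 is the $\mathbb{Z}[\mathcal{P}]$-subalgebra of $\mathcal{F}$ generated by $\mathcal{X}$. It is of finite type if $\mathcal{S}$ is finite. $\mathcal{A}(\mathcal{S})\subset\mathcal{F}$ and $\mathcal{A}(\mathcal{S}')\subset\mathcal{F}'$ over the same $\mathbb{P}$ are strongly isomorphic if some $\mathbb{Z}\mathbb{P}$-algebra isomorphism $\mathcal{F}\to\mathcal{F}'$ transports some (equivalently, any) seed of $\mathcal{S}$ to a seed of $\mathcal{S}'$. Up to strong isomorphism, the algebra is determined by $B$ and $\mathbf{p}$ of any one seed and is denoted $\mathcal{A}(B,\mathbf{p})$; it is defined if and only if every matrix obtained from $B$ by a sequence of mutations is sign-skew-symmetric (in particular if $B$ is skew-symmetrizable, which holds when $A(B)$ is a Cartan matrix of finite type). Cartan counterpart. For an integer square matrix $B=(b_{ij})$, $A(B)=(a_{ij})$ is given by $a_{ii}=2$ and $a_{ij}=-|b_{ij}|$ for $i\ne j$. Cartan matrices of finite type need not be indecomposable. *)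

(* Defs.v *)
From HB Require Import structures.
From Stdlib Require Import Relations.
From mathcomp Require Import all_boot all_order all_algebra finmap.
From mathcomp Require Import boolp classical_sets functions cardinality.
From mathcomp Require Import reals.
From mathcomp Require Import monalg.
From mathcomp Require mpoly.

Set Implicit Arguments.
Unset Strict Implicit.
Unset Printing Implicit Defensive.

Import GRing.Theory Num.Theory.

Local Open Scope fset_scope.
Local Open Scope ring_scope.

HB.mixin Record Group_isSemifield P of Group P := {
  semifield_mulC : forall p q : P, (p * q = q * p)%g;
  oplus : P -> P -> P;
  oplusA : associative oplus;
  oplusC : commutative oplus;
  mulg_oplusr : forall p q r : P, (p * oplus q r = oplus (p * q) (p * r))%g
}.

#[short(type="semifieldType")]
HB.structure Definition Semifield := {P of Group_isSemifield P & Group P}.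

Arguments oplus {s} : rename.

Section SemifieldTheory.
Variable P : semifieldType.
Local Open Scope group_scope.
Implicit Types p q : P.

Lemma semifield_torsionfree p m : (0 < m)%N -> p ^+ m = 1 -> p = 1.
Proof.
case: m => // m _ pm1.
pose s := fix s k : P := if k is k'.+1 then oplus (p ^+ k) (s k') else 1.
have ps k : oplus 1 (p * s k) = s k.+1.
  elim: k => [|k IH] /=; first by rewrite mulg1 oplusC expg1.
  rewrite mulg_oplusr -expgS oplusA (oplusC 1) -oplusA; congr oplus.
  exact: IH.
have : p * s m = s m.
  case: m pm1 ps => [|m] pm1 ps; first by rewrite /= mulg1 -[p]expg1.
  by rewrite [s m.+1]/= mulg_oplusr -expgS pm1 [LHS]ps.
by move/(canRL (mulgK _)); rewrite mulgV.
Qed.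

(* A group without torsion is totally ordered by a maximal cone (Zorn); this is
   what makes the group ring a domain. *)
Definition cone (C : set P) :=
  (forall x y, C x -> C y -> C (x * y)) /\ (forall x, C x -> C x^-1 -> x = 1).

Lemma total_cone : exists C : set P,
  cone C /\ forall x, x != 1 -> C x \/ C x^-1.
Proof.
have [|C [Ccone Cmax]] := @Zorn_bigcup P cone.
  move=> F Fcone Ftot.
  have two x y : (\bigcup_(X in F) X)%classic x -> (\bigcup_(X in F) X)%classic y ->
      exists2 X, F X & X x /\ X y.
    move=> [X FX Xx] [Y FY Yy]; case: (Ftot _ _ FX FY) => sub.
      by exists Y => //; split=> //; apply: sub.
    by exists X => //; split=> //; apply: sub.
  split=> x.
    move=> y Cx Cy; have [X FX [Xx Xy]] := two _ _ Cx Cy.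
    by exists X => //; apply: (Fcone _ FX).1.
  move=> Cx Cy; have [X FX [Xx Xy]] := two _ _ Cx Cy.
  exact: (Fcone _ FX).2.
exists C; split=> // x x1.
have [mC pC] := Ccone.
pose C1 : set P := fun y => y = 1 \/ C y.
have mC1 y z : C1 y -> C1 z -> C1 (y * z).
  move=> [->|Cy] [->|Cz]; rewrite ?mulg1 ?mul1g; [by left| by right..|].
  by right; apply: mC.
have pC1 y : C1 y -> C1 y^-1 -> y = 1.
  move=> [//|Cy] [yV|Cy']; last exact: pC.
  by rewrite -[y]invgK yV invg1.
have XC1 y m : C1 y -> C1 (y ^+ m).
  by move=> Cy; elim: m => [|m IH]; [left|rewrite expgS; apply: mC1].
have ext z : ~ C z -> exists2 m, (0 < m)%N & C1 (z ^+ m)^-1.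
  move=> nCz; apply: contrapT => nz.
  pose D : set P := fun y => exists2 c, C1 c & exists k, y = c * z ^+ k.
  have CD : (C `<=` D)%classic.
    by move=> c Cc; exists c; [right|exists 0%N; rewrite mulg1].
  have Dz : D z by exists 1; [left|exists 1%N; rewrite mul1g expg1].
  apply: (Cmax D).
    by split=> // DC; apply: nCz; apply: DC.
  split=> [y w [c Cc [k ->]] [d Cd [l ->]]|y [c Cc [k yE]] [d Cd [l yVE]]].
    exists (c * d); first exact: mC1.
    exists (k + l)%N.
    by rewrite expgnDr -!mulgA; congr (_ * _); rewrite !mulgA;
       congr (_ * _); rewrite semifield_mulC.
  have cd : c * d * z ^+ (k + l) = 1.
    rewrite -(mulgV y) yVE yE expgnDr -!mulgA; congr (_ * _).
    by rewrite !mulgA; congr (_ * _); rewrite semifield_mulC.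
  have cdV : c * d = (z ^+ (k + l))^-1.
    by rewrite -[LHS]mulg1 -(mulgV (z ^+ (k + l))) mulgA cd mul1g.
  have [kl0|kl0] := posnP (k + l).
    move: kl0 => /eqP; rewrite addn_eq0 => /andP[/eqP k0 /eqP l0].
    move: yE yVE; rewrite k0 l0 !mulg1 => yE yVE.
    by apply: pC1; [rewrite yE|rewrite yVE].
  by case: nz; exists (k + l)%N => //; rewrite -cdV; apply: mC1.
apply: contrapT => /not_orP[/ext[m m0 Cm] /ext[l l0 Cl]].
move: Cl; rewrite expVgn invgK => Cl.
case/eqP: x1.
apply: (@semifield_torsionfree x (m * l)); first by rewrite muln_gt0 m0.
apply: pC1; first by rewrite mulnC expgnA; apply: XC1.
by rewrite expgnA -expVgn; apply: XC1.
Qed.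

End SemifieldTheory.

(* The group ring Z P. The product of monalg is only available for monoids
   without nontrivial units. *)
Definition gring (P : semifieldType) : Type := {malg int[P]}.

HB.instance Definition _ (P : semifieldType) := GRing.Zmodule.on (gring P).

Section GroupRing.
Variable P : semifieldType.
Implicit Types (g : {malg int[P]}) (p q : P).

Definition gelt p : gring P := << 1 *g p >>.

Definition gmul g1 g2 : {malg int[P]} :=
  \sum_(p <- msupp g1) \sum_(q <- msupp g2) << g1@_p * g2@_q *g (p * q)%g >>.

Lemma gmulw (d1 d2 : {fset P}) g1 g2 :
  msupp g1 `<=` d1 -> msupp g2 `<=` d2 ->
  gmul g1 g2 = \sum_(p <- d1) \sum_(q <- d2) << g1@_p * g2@_q *g (p * q)%g >>.
Proof.
move=> le_d1 le_d2; rewrite /gmul (big_fset_incl _ le_d1) /=.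
  apply/eq_bigr=> k1 _; apply/big_fset_incl => // k _ /mcoeff_outdom ->.
  by rewrite mulr0 monalgU0.
move=> k _ /mcoeff_outdom g1k.
by rewrite big1 => // k' _; rewrite g1k mul0r monalgU0.
Qed.

Lemma gmulC : commutative gmul.
Proof.
move=> g1 g2; rewrite /gmul exchange_big /=.
apply: eq_bigr => p _; apply: eq_bigr => q _.
by rewrite mulrC semifield_mulC.
Qed.

Lemma gmul0g : left_zero 0 gmul.
Proof. by move=> g; rewrite /gmul msupp0 big_seq_fset0. Qed.

Lemma gmulUg c p g :
  gmul << c *g p >> g = \sum_(q <- msupp g) << c * g@_q *g (p * q)%g >>.
Proof.
rewrite (gmulw msuppU_le (fsubset_refl _)) big_seq_fset1.
by apply/eq_bigr => k' _; rewrite mcoeffUU.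
Qed.

Lemma gmulUU c1 c2 p1 p2 :
  gmul << c1 *g p1 >> << c2 *g p2 >> = << c1 * c2 *g (p1 * p2)%g >>.
Proof. by rewrite (gmulw msuppU_le msuppU_le) !big_seq_fset1 !mcoeffUU. Qed.

Lemma gmulE1 g1 g2 :
  gmul g1 g2 = \sum_(p <- msupp g1) gmul << g1@_p *g p >> g2.
Proof. by apply/eq_bigr=> k _; rewrite gmulUg. Qed.

Lemma gmul1g : left_id (gelt 1%g) gmul.
Proof.
move=> g; rewrite gmulUg [RHS]monalgE.
by apply/eq_bigr=> kg _; rewrite mul1r mul1g.
Qed.

Lemma gmulDl : left_distributive gmul +%R.
Proof.
move=> g1 g2 g; rewrite [in RHS](gmulw (fsubsetUl _ (msupp g2)) (fsubset_refl _)).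
rewrite [in RHS](gmulw (fsubsetUr (msupp g1) _) (fsubset_refl _)).
rewrite (gmulw (msuppD_le _ _) (fsubset_refl _)).
rewrite -big_split /=; apply/eq_bigr=> k1 _.
rewrite -big_split /=; apply/eq_bigr=> k2 _.
by rewrite mcoeffD mulrDl monalgUD.
Qed.

Lemma gmulDr : right_distributive gmul +%R.
Proof. by move=> g g1 g2; rewrite !(gmulC g) gmulDl. Qed.

Lemma gmulg0 : right_zero 0 gmul.
Proof. by move=> g; rewrite gmulC gmul0g. Qed.

Lemma gmulA : associative gmul.
Proof.
move=> g1 g2 g3.
have suml (I : Type) (s : seq I) F g :
    gmul (\sum_(i <- s) F i) g = \sum_(i <- s) gmul (F i) g.
  exact: (big_morph (gmul^~ g) (fun _ _ => gmulDl _ _ _) (gmul0g _)).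
have sumr (I : Type) (s : seq I) F g :
    gmul g (\sum_(i <- s) F i) = \sum_(i <- s) gmul g (F i).
  exact: (big_morph (gmul g) (fun _ _ => gmulDr _ _ _) (gmulg0 _)).
rewrite gmulE1 [gmul g1 g2]gmulE1 suml; apply: eq_bigr => p _.
rewrite [gmul g2 g3]gmulE1 [in RHS](monalgE g2) !sumr suml.
apply: eq_bigr => q _.
rewrite [in LHS](monalgE g3) [in RHS](monalgE g3).
rewrite (sumr _ _ _ << g2@_q *g q >>) (sumr _ _ _ << g1@_p *g p >>) sumr.
apply: eq_bigr => r _.
by rewrite !gmulUU mulrA mulgA.
Qed.

Lemma gone_neq0 : gelt 1%g != 0.
Proof. by rewrite monalgU_eq0 oner_eq0. Qed.

End GroupRing.

HB.instance Definition _ (P : semifieldType) :=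
  GRing.Zmodule_isComNzRing.Build (gring P)
    (@gmulA P) (@gmulC P) (@gmul1g P) (@gmulDl P) (@gone_neq0 P).

Section GroupRingDomain.
Variable P : semifieldType.
Implicit Types (g : gring P) (p q : P).

Lemma gring_idomain g1 g2 : g1 * g2 = 0 -> (g1 == 0) || (g2 == 0).
Proof.
have [C [[mC pC] tC]] := total_cone P.
have minP (s : seq P) x : exists m, m \in x :: s /\
    forall y, y \in x :: s -> y != m -> C (y * m^-1)%g.
  elim: s x => [|z s IH] x.
    exists x; rewrite mem_head; split=> // y; rewrite inE => /eqP->.
    by rewrite eqxx.
  have [m [ms mmin]] := IH z.
  have [->|xm] := eqVneq x m.
    exists m; rewrite mem_head; split=> // y; rewrite inE.
    by case/predU1P => [->|]; [rewrite eqxx|exact: mmin].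
  case: (tC (x * m^-1)%g).
  - by apply: contra_neq xm => /(canRL (mulgVK _)); rewrite mul1g.
  - move=> Cx; exists m; rewrite inE ms orbT; split=> // y; rewrite inE.
    by case/predU1P => [->//|]; exact: mmin.
  rewrite invgM invgK => Cm; exists x; rewrite mem_head; split=> // y.
  rewrite inE; case/predU1P => [->|ys yx]; first by rewrite eqxx.
  have [->//|ym] := eqVneq y m.
  have -> : (y * x^-1 = (y * m^-1) * (m * x^-1))%g by rewrite mulgA mulgVK.
  by apply: mC => //; apply: mmin.
have minS g : g != 0 -> exists m, m \in msupp g /\
    forall y, y \in msupp g -> y != m -> C (y * m^-1)%g.
  move=> g0; case E: (enum_fset (msupp g)) => [|x s].
    case/eqP: g0; rewrite [g]monalgE; rewrite E big_nil //.
  have [m [ms mmin]] := minP s x; exists m; split.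
    by rewrite -[_ \in _]/(m \in enum_fset _) E.
  by move=> y yg; apply: mmin; rewrite -E.
move=> g120; apply: contrapT => /negP; rewrite negb_or => /andP[].
move=> /minS[a [ag amin]] /minS[b [bg bmin]].
move: (congr1 (fun g : {malg int[P]} => g@_(a * b)%g) g120).
have -> : (g1 * g2 : {malg int[P]})@_(a * b)%g = g1@_a * g2@_b.
  rewrite [g1 * g2]/(gmul g1 g2) raddf_sum (big_fsetD1 a) //=.
  rewrite raddf_sum (big_fsetD1 b) //= mcoeffUU.
  have C1 p q : p \in msupp g1 -> q \in msupp g2 -> (p != a) || (q != b) ->
      (p * q)%g != (a * b)%g.
    move=> pg qg pq; apply/eqP => E.
    have E1 : (p * a^-1 * (q * b^-1) = 1)%g.
      rewrite mulgA -(mulgA p) (semifield_mulC a^-1%g) !mulgA E.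
      by rewrite -(mulgA a) (semifield_mulC b) mulgA mulgK mulgV.
    have [pa|pa] := eqVneq p a.
      move: pq; rewrite pa eqxx /=; case/eqP.
      by move: E; rewrite pa => /mulgI.
    have [qb|qb] := eqVneq q b.
      by case/eqP: pa; move: E; rewrite qb => /mulIg.
    have Cp := amin _ pg pa; have Cq := bmin _ qg qb.
    have E2 : (q * b^-1 = (p * a^-1)^-1)%g.
      by rewrite -[LHS](mulKg (p * a^-1)%g) E1 mulg1.
    have := pC _ Cp; rewrite -E2 => /(_ Cq) /(canRL (mulgVK _)).
    by rewrite mul1g; apply/eqP.
  rewrite big1_fset ?addr0; last first.
    move=> q; rewrite !inE => /andP[qb qg] _.
    rewrite mcoeffU (negPf (C1 _ _ ag qg _)) ?mulr0n //.
    by rewrite qb orbT.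
  rewrite big1_fset ?addr0 // => p; rewrite !inE => /andP[pa pg] _.
  rewrite raddf_sum big1_fset //= => q qg _.
  by rewrite mcoeffU (negPf (C1 _ _ pg qg _)) ?mulr0n // pa.
rewrite mcoeff0 => /eqP; rewrite mulf_eq0.
by rewrite !mcoeff_eq0 ag bg.
Qed.

Definition gring_unit : pred (gring P) := fun g => `[< exists h, h * g = 1 >].
Definition gring_inv g : gring P :=
  if pselect (exists h, h * g = 1) is left e then projT1 (cid e) else g.

Fact gring_mulVr : {in gring_unit, left_inverse 1 gring_inv *%R}.
Proof.
move=> g /asboolP gu; rewrite /gring_inv; case: pselect => // e.
by case: cid.
Qed.

Fact gring_unitP g h : h * g = 1 -> g \in gring_unit.
Proof. by move=> hg; apply/asboolP; exists h. Qed.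

Fact gring_inv_out : {in [predC gring_unit], gring_inv =1 id}.
Proof.
move=> g; rewrite inE /= => /asboolP gu; rewrite /gring_inv.
by case: pselect.
Qed.

End GroupRingDomain.

HB.instance Definition _ (P : semifieldType) :=
  GRing.ComNzRing_hasMulInverse.Build (gring P)
    (@gring_mulVr P) (@gring_unitP P) (@gring_inv_out P).
HB.instance Definition _ (P : semifieldType) :=
  GRing.ComUnitRing_isIntegral.Build (gring P) (@gring_idomain P).

(* From here on, mcoeff, meval, etc. refer to mpoly. *)
Import mpoly.

Definition gexpz (G : groupType) (p : G) (b : int) : G :=
  match b with Posz m => (p ^+ m)%g | Negz m => (p ^- m.+1)%g end.

(* K : set F is meant to be a subfield of F; the coefficients of polynomials
   over K are kept in F. *)
Section Transcendence.
Variables (F : fieldType) (K : set F).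

Definition coefs_in n (q : mpoly n F) : Prop := forall m, K (mcoeff m q).

Definition alg_independent n (x : 'I_n -> F) : Prop :=
  forall q : mpoly n F, coefs_in q -> meval x q = 0 -> q = 0.

(* The subfield K(x_0, .., x_(n-1)) of F. *)
Definition adjoined n (x : 'I_n -> F) : set F :=
  [set u | exists q r : mpoly n F,
    [/\ coefs_in q, coefs_in r, meval x r != 0 & u = meval x q / meval x r]].

End Transcendence.

Definition algebraic_over (F : fieldType) (K : set F) (u : F) : Prop :=
  exists f : {poly F}, [/\ f != 0, forall i, K f`_i & root f u].

Definition transcendence_basis (F : fieldType) (K : set F) n
    (x : 'I_n -> F) : Prop :=
  alg_independent K x /\ forall u : F, algebraic_over (adjoined K x) u.

Record ambient (P : semifieldType) (n : nat) := Ambient {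
  ambient_field :> fieldType;
  scal : {rmorphism gring P -> ambient_field};
  ambientP :
    exists phi : {rmorphism {fraction (mpoly n (gring P))} -> ambient_field},
      bijective phi /\
      forall a : gring P, phi (FracField.tofrac (mpolyC n a)) = scal a
}.

Definition sign_skew_symmetric (I : Type) (B : I -> I -> int) : Prop :=
  forall i j, (B i j = 0 /\ B j i = 0) \/ B i j * B j i < 0.

(* The division by 2 is exact: the numerator is 0 or +/- 2 |B i k| |B k j|. *)
Definition matrix_mutation (I : eqType) (B : I -> I -> int) (k i j : I) : int :=
  if (i == k) || (j == k) then - B i j
  else B i j + divz (`|B i k| * B k j + B i k * `|B k j|) 2.

Section Seeds.
Variables (P : semifieldType) (n : nat) (F : ambient P n).

Definition coef (p : P) : F := scal F (gelt p).

Definition scal_frac : set F :=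
  [set u | exists a b : gring P, u = scal F a / scal F b].

(* Families indexed by the cluster are extended to F by a default value (1 for
   the coefficients, 0 for the matrix), so that seeds with the same cluster and
   the same entries are equal. *)
Record seed := Seed {
  cluster : {fset F};
  pplus : {fsfun F -> P with 1%g};
  pminus : {fsfun F -> P with 1%g};
  bmat : {fsfun F * F -> int with 0};
  seed_card : #|` cluster| = n;
  seed_basis :
    transcendence_basis scal_frac (fun i : 'I_n => (cluster : seq F)`_i);
  pplus_supp : finsupp pplus `<=` cluster;
  pminus_supp : finsupp pminus `<=` cluster;
  bmat_supp : finsupp bmat `<=` cluster `*` cluster;
  seed_normal : forall x, x \in cluster -> oplus (pplus x) (pminus x) = 1%g;
  seed_sss : sign_skew_symmetric (fun x y => bmat (x, y))
}.

Implicit Types (S : seed) (x y z : F).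

Definition bentry S x y : int := bmat S (x, y).

Definition exchange_relation S z zbar : Prop :=
  z * zbar =
    coef (pplus S z) * \prod_(x <- cluster S | 0 < bentry S x z) x ^+ `|bentry S x z|%N +
    coef (pminus S z) * \prod_(x <- cluster S | bentry S x z < 0) x ^+ `|bentry S x z|%N.

(* S' is the mutation of S in direction z. As S' is a seed, its coefficients are
   normalized, hence determined by their ratios. *)
Definition mutation S z S' : Prop :=
  z \in cluster S /\ exists zbar : F,
  [/\ exchange_relation S z zbar,
      cluster S' = zbar |` (cluster S `\ z),
      forall x, x \in cluster S' ->
        (pplus S' x / pminus S' x =
         if x == zbar then pminus S z / pplus S z
         else if (0 <= bentry S z x)%R
           then gexpz (pplus S z) (bentry S z x) * (pplus S x / pminus S x)
           else gexpz (pminus S z) (bentry S z x) * (pplus S x / pminus S x))%g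
    & let old x := if x == zbar then z else x in
      forall x y, x \in cluster S' -> y \in cluster S' ->
        bentry S' x y = matrix_mutation (bentry S) z (old x) (old y)].

Definition adjacent S S' : Prop := exists z, mutation S z S'.

Definition has_initial_data S (B : 'M[int]_n) (p : 'I_n -> P * P) : Prop :=
  exists x : 'I_n -> F,
    [/\ injective x, cluster S = [fset x i | i : 'I_n],
        forall i, (pplus S (x i), pminus S (x i)) = p i
      & forall i j, bentry S (x i) (x j) = B i j].

End Seeds.

(* A cluster algebra is given by its ambient field and its set of seeds. That
   this set is nonempty is implicit in the usual definition. *)
Record cluster_algebra (P : semifieldType) (n : nat) := ClusterAlgebra {
  ca_field : ambient P n;
  seeds : set (seed ca_field);
  seeds_nonempty : exists S, seeds S;
  seeds_mutation : forall S z, seeds S -> z \in cluster S ->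
    exists2 S', seeds S' & mutation S z S';
  seeds_connected : forall S S', seeds S -> seeds S' ->
    clos_refl_trans _ (@adjacent P n ca_field) S S'
}.

Arguments seeds {P n} c : rename.

Section ClusterAlgebras.
Variables (P : semifieldType) (n : nat).
Implicit Types A : cluster_algebra P n.

Definition cluster_variables A : set (ca_field A) :=
  [set x | exists2 S, seeds A S & x \in cluster S].

Definition coefficients A : set P :=
  [set p | exists S x,
    [/\ seeds A S, x \in cluster S & p = pplus S x \/ p = pminus S x]].

(* The underlying ring: as a subring of the ambient field, the
   Z[coefficients]-algebra generated by the cluster variables. *)
Definition ca_carrier A : set (ca_field A) :=
  smallest (fun D : set (ca_field A) => GRing.subring_closed (mem D))
    (@coef P n (ca_field A) @` coefficients A `|` @cluster_variables A)%classic.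

Definition finite_type A : Prop := finite_set (seeds A).

Definition transports (F F' : ambient P n) (phi : F -> F')
    (S : seed F) (S' : seed F') : Prop :=
  [/\ cluster S' = [fset phi x | x in cluster S],
      forall x, x \in cluster S ->
        pplus S' (phi x) = pplus S x /\ pminus S' (phi x) = pminus S x
    & forall x y, x \in cluster S -> y \in cluster S ->
        bentry S' (phi x) (phi y) = bentry S x y].

Definition strongly_isomorphic A A' : Prop :=
  exists phi : {rmorphism ca_field A -> ca_field A'},
    [/\ bijective phi,
        forall a : gring P, phi (scal (ca_field A) a) = scal (ca_field A') a
      & exists S S', [/\ seeds A S, seeds A' S' & transports phi S S']].

(* A is (a representative of) A(B, p). *)
Definition is_cluster_algebra_of A (B : 'M[int]_n) (p : 'I_n -> P * P) : Prop :=
  exists2 S, seeds A S & has_initial_data S B p.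

End ClusterAlgebras.

Definition cartan_counterpart n (B : 'M[int]_n) : 'M[int]_n :=
  \matrix_(i, j) if i == j then 2 else - `|B i j|.

Definition positive_definite n (M : 'M[int]_n) : Prop :=
  M^T = M /\ forall (R : realType) (v : 'rV[R]_n),
    v != 0 -> 0 < (v *m map_mx intr M *m v^T) ord0 ord0.

Definition cartan_finite_type n (A : 'M[int]_n) : Prop :=
  [/\ forall i, A i i = 2, forall i j, i != j -> A i j <= 0
    & exists d : 'rV[int]_n,
        (forall i, 0 < d ord0 i) /\ positive_definite (diag_mx d *m A)].

(* Main.v *)
From HB Require Import structures.
Require Import Defs.
From mathcomp Require Import boolp classical_sets cardinality reals.
From mathcomp Require Import all_boot all_order all_algebra finmap.
From mathcomp Require monalg.
From mathcomp Require Import mpoly.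
From mathcomp Require Import zify ring lra.

(** Throughout, b_xy > 0 is pictured as an arrow x -> y.  The algebra A serves
    as its own model: it suffices to find, among its seeds, one whose exchange
    matrix is bipartite (every vertex is a source or a sink) and whose Cartan
    counterpart is symmetrizable and positive definite.

    Finiteness enters through a single obstruction, lemma [growth].  Let I be a
    set of indices on which the arrows of B increase some function h.  Mutating
    at the elements of I in the order of h, each one is a source of I when its
    turn comes, and after the sweep the block of B on I is the initial one, so
    that sweeps can be iterated.  Setting the initial cluster variables and all
    elements of the semifield to 1 gives every cluster variable that is met a
    well-defined positive value, and the values y_t(i) after t sweeps satisfy
        y_{t+1}(i) y_t(i) = 1 + a monomial with exponents |b_ji|,
    each factor taken before or after its own update.  Finitely many cluster
    variables make the values periodic.  If G_i is the product of the y_t(i)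
    over a period, then G_i > 1 and G_i ^ 2 > prod_j G_j ^ |b_ji|; hence no
    nonzero eta >= 0 satisfies 2 eta_j <= sum_i |b_ji| eta_i for all j in I.
    Two cases are used.  With eta = 1: no cycle of the graph of B carries an
    acyclic orientation ([cycle_not_acyclic]).  When I is bipartite, a theorem
    of the alternative for matrices with nonpositive off-diagonal entries
    ([Zmatrix_alternative]) gives u > 0 with sum_i u_i |b_ik| < 2 u_k
    ([bipartite_weights]), which is the finite type condition for I.

    The good seed is built by growing a bipartite symmetrizable set of vertices
    one vertex at a time ([grow_component], [start_component]).  Let W be the
    connected component being built and v an outside vertex joined to W.  While
    v has at least two neighbours in W, the cycle obstruction forces every
    triangle v -> source -> sink -> v to be oriented and every neighbour of v in
    W to lie on one ([two_neighbours_orientation]).  Mutating at all sinks of W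
    then reverses W and acts linearly on the entries joining W and v, as half a
    Coxeter transformation, keeping them of the prescribed signs.  Such signs
    cannot persist: pairing these entries with u gives a sequence of
    nonnegative integers which is strictly concave ([sink_sweep]).  So v ends up
    with exactly one neighbour in W, and then, up to a mutation at v itself,
    adding v to W keeps it bipartite, symmetrizable and connected.

    Once all vertices are included, the symmetrizer and the weights u give
    positive definiteness by completing squares ([Zmatrix_quadratic_gt0]). *)

Set Implicit Arguments.
Unset Strict Implicit.
Unset Printing Implicit Defensive.

Import Order.TTheory GRing.Theory Num.Theory.
Local Open Scope ring_scope.

(** * Matrices with nonpositive off-diagonal entries *)

(** Elimination of one variable by Schur complement, without divisions: when the
    diagonal entry is positive, the complement has again nonpositive off-diagonal
    entries, and either alternative lifts from it.  A nonpositive diagonal entry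
    gives the first alternative by a coordinate vector. *)
Lemma Zmatrix_alternative n (A : 'I_n -> 'I_n -> int) :
  (forall i j, i != j -> A i j <= 0) ->
  (exists eta : 'I_n -> int, [/\ forall i, 0 <= eta i, exists i, 0 < eta i
      & forall j, \sum_i A j i * eta i <= 0]) \/
  (exists u : 'I_n -> int, (forall i, 0 < u i) /\
      forall i, 0 < \sum_j u j * A j i).
Proof.
elim: n A => [|n IH] A Aoff.
  by right; exists (fun=> 0); split=> [] [].
pose a := A ord0 ord0; pose r i := A ord0 (lift ord0 i).
pose c i := A (lift ord0 i) ord0.
have r_le0 i : r i <= 0 by apply: Aoff.
have c_le0 i : c i <= 0 by apply: Aoff.
have [a_le0|a_gt0] := lerP a 0.
  left; exists (fun i => (i == ord0)%:Z); split=> [i||j].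
  - by [].
  - by exists ord0; rewrite eqxx.
  rewrite (bigD1 ord0) //= big1 => [|i /negPf ->]; last by rewrite mulr0.
  rewrite mulr1 addr0; have [->//|j0] := eqVneq j ord0.
  exact: Aoff.
have [i j ij||] := IH (fun i j => a * A (lift ord0 i) (lift ord0 j) - c i * r j).
- have : A (lift ord0 i) (lift ord0 j) <= 0 by apply: Aoff.
  by have := c_le0 i; have := r_le0 j; nia.
- case=> eta [eta0 [i0 eta_gt0] etaA]; left.
  exists (fun i => if unlift ord0 i is Some k then a * eta k
                   else - \sum_k r k * eta k).
  split=> [i||j].
  + case: unliftP => [k _|_]; first by rewrite mulr_ge0 // ltW.
    rewrite oppr_ge0; apply: sumr_le0 => k _.
    by rewrite mulr_le0_ge0.
  + by exists (lift ord0 i0); rewrite liftK mulr_gt0.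
  pose r' j (i : 'I_n) := A j (lift ord0 i).
  rewrite big_ord_recl unlift_none.
  rewrite [X in _ + X](eq_bigr (fun i => a * (r' j i * eta i))) => [|i _]; last first.
    by rewrite (liftK ord0 i) mulrCA.
  rewrite -mulr_sumr {}/r'.
  have [k ->|->] := unliftP ord0 j; last by rewrite -/a /r mulrN addNr.
  apply: le_trans (etaA k); rewrite -/(c k) mulrN mulr_sumr mulr_sumr.
  rewrite addrC -sumrB; apply: ler_sum => i _.
  by rewrite mulrBl !mulrA.
- case=> u [u_gt0 uA]; right.
  (* u is scaled by K a, with K large enough to absorb the entries r i of the
     eliminated row; the 1 in the new coordinate makes its own column sum a. *)
  pose K := 1 - \sum_i r i.
  have K1 i : 1 <= K + r i.
    rewrite /K (bigD1 i) //=; set s := \sum_(_ < _ | _) _.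
    have s_le0 : s <= 0 by apply: sumr_le0.
    by move: s s_le0 (r i) => s s_le0 ri; lia.
  have K_gt0 : 0 < K.
    have : \sum_i r i <= 0 by apply: sumr_le0.
    by rewrite /K; lia.
  exists (fun i => if unlift ord0 i is Some k then K * a * u k
                   else 1 - K * \sum_k u k * c k).
  split=> [i|i].
    case: unliftP => [k _|_]; first by rewrite !mulr_gt0.
    have : \sum_k u k * c k <= 0.
      by apply: sumr_le0 => k _; have := u_gt0 k; have := c_le0 k; nia.
    by nia.
  rewrite big_ord_recl unlift_none.
  rewrite [X in _ + X](eq_bigr (fun j : 'I_n => K * a * u j * A (lift ord0 j) i));
      last first.
    by move=> j _; rewrite (liftK ord0 j).
  have [k ->|->] := unliftP ord0 i.
    pose X := \sum_i u i * A (lift ord0 i) (lift ord0 k).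
    pose Y := \sum_i u i * c i.
    have XY : 0 < a * X - Y * r k.
      rewrite /X /Y mulr_sumr mulr_suml -sumrB.
      under eq_bigr do rewrite mulrCA -mulrA -mulrBr.
      exact: uA.
    have -> : \sum_(i < n) K * a * u i * A (lift ord0 i) (lift ord0 k) = K * a * X.
      by rewrite mulr_sumr; apply: eq_bigr => j _; rewrite mulrA.
    rewrite -/(r k) -/Y; have Krk := K1 k.
    by move: XY Krk; move: X Y (r k) => X Y rk; nia.
  have -> : \sum_i K * a * u i * A (lift ord0 i) ord0 = K * a * \sum_i u i * c i.
    by rewrite mulr_sumr; apply: eq_bigr => j _; rewrite mulrA.
  by rewrite -/a; nia.
Qed.

(** In the coordinates y_i = x_i / w_i the form is the sum of the squares y_j ^ 2
    with the weights w_j sum_i w_i N_ij > 0, minus half the sum of the nonpositive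
    w_i w_j N_ij (y_i - y_j) ^ 2. *)
Lemma Zmatrix_quadratic_gt0 (R : realFieldType) n (N : 'I_n -> 'I_n -> R)
    (w x : 'I_n -> R) k :
  (forall i j, N i j = N j i) -> (forall i j, i != j -> N i j <= 0) ->
  (forall i, 0 < w i) -> (forall j, 0 < \sum_i w i * N i j) -> x k != 0 ->
  0 < \sum_i \sum_j x i * N i j * x j.
Proof.
move=> symN offN w_gt0 wN xk; pose y i := x i / w i.
have xE i : x i = w i * y i by rewrite mulrC divfK ?gt_eqF.
pose D := \sum_j w j * (\sum_i w i * N i j) * y j ^+ 2.
pose E := \sum_i \sum_j w i * w j * N i j * (y i - y j) ^+ 2.
have E_le0 : E <= 0.
  apply: sumr_le0 => i _; apply: sumr_le0 => j _.
  have [->|ij] := eqVneq i j; first by rewrite subrr expr0n mulr0.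
  by rewrite mulr_le0_ge0 ?sqr_ge0 // mulr_ge0_le0 ?offN // mulr_ge0 // ltW.
have D_gt0 : 0 < D.
  rewrite /D (bigD1 k) //= ltr_wpDr //.
    by apply: sumr_ge0 => j _; rewrite mulr_ge0 ?sqr_ge0 // mulr_ge0 // ltW.
  apply: mulr_gt0; first exact: mulr_gt0.
  by rewrite exprn_even_gt0 //= mulf_neq0 // invr_neq0 // gt_eqF.
have Dl : D = \sum_i \sum_j w i * w j * N i j * y j ^+ 2.
  rewrite exchange_big; apply: eq_bigr => j _.
  rewrite mulr_sumr mulr_suml; apply: eq_bigr => i _; ring.
have Dr : D = \sum_i \sum_j w i * w j * N i j * y i ^+ 2.
  apply: eq_bigr => j _; rewrite mulr_sumr mulr_suml.
  by apply: eq_bigr => i _; rewrite (symN i j); ring.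
suff : 2 * \sum_i \sum_j x i * N i j * x j = D + D - E by lra.
rewrite {1}Dl Dr -big_split -sumrB mulr_sumr /=; apply: eq_bigr => i _.
rewrite -big_split -sumrB mulr_sumr /=; apply: eq_bigr => j _.
by rewrite !xE; ring.
Qed.

(** Dividing the left weights u of the Cartan counterpart by the symmetrizer d
    gives weights for the symmetrized matrix. *)
Lemma cartan_counterpart_finite_type n (B : 'M[int]_n) (d u : 'I_n -> int) :
  (forall i, B i i = 0) ->
  (forall i, 0 < d i) -> (forall i j, d i * `|B i j| = d j * `|B j i|) ->
  (forall i, 0 < u i) -> (forall k, \sum_i u i * `|B i k| < 2 * u k) ->
  cartan_finite_type (cartan_counterpart B).
Proof.
move=> Bii d_gt0 symB u_gt0 uB.
pose C := cartan_counterpart B.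
have offC i j : i != j -> C i j = - `|B i j| by move=> /negPf ij; rewrite mxE ij.
have diagC i : C i i = 2 by rewrite mxE eqxx.
split=> // [i j ij|]; first by rewrite offC // oppr_le0.
exists (\row_i d i); split=> [i|]; first by rewrite mxE.
have ME i j : (diag_mx (\row_i d i) *m C) i j = d i * C i j.
  by rewrite mul_diag_mx mxE [in LHS]mxE.
have symC i j : d i * C i j = d j * C j i.
  have [->//|ij] := eqVneq i j; rewrite !offC // 1?eq_sym //.
  by rewrite !mulrN symB.
split=> [|R v v0]; first by apply/matrixP => i j; rewrite mxE !ME.
have /rV0Pn[k vk] := v0.
have -> : (v *m map_mx intr (diag_mx (\row_i d i) *m C) *m v^T) ord0 ord0 =
    \sum_i \sum_j v ord0 i * (d i * C i j)%:~R * v ord0 j.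
  rewrite mxE exchange_big; apply: eq_bigr => j _.
  by rewrite !mxE mulr_suml; apply: eq_bigr => i _; rewrite mxE ME.
apply: (Zmatrix_quadratic_gt0 (w := fun i => (u i)%:~R / (d i)%:~R) (k := k)) => //.
- by move=> i j; rewrite symC.
- by move=> i j ij; rewrite lerz0 offC // mulrN oppr_le0 mulr_ge0 // ltW.
- by move=> i; rewrite divr_gt0 ?ltr0z.
move=> j; have -> : \sum_i (u i)%:~R / (d i)%:~R * (d i * C i j)%:~R =
    (\sum_i u i * C i j)%:~R :> R.
  rewrite rmorph_sum; apply: eq_bigr => i _; rewrite !rmorphM /= mulrA divfK //.
  by rewrite intr_eq0 gt_eqF.
rewrite ltr0z (bigD1 j) //= diagC (eq_bigr (fun i => - (u i * `|B i j|))) => [|i ij].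
  by rewrite sumrN subr_gt0; have := uB j; rewrite (bigD1 j) //= Bii normr0 mulr0 add0r mulrC.
by rewrite offC // mulrN.
Qed.

(** * Periodic solutions of exchange recurrences *)

(** The values before and after an update have the same product over a period, so
    the products G of the values satisfy G_k ^ 2 > prod_i G_i ^ c_ik and G_k > 1.
    Raising the first inequality to the powers eta_k and multiplying contradicts
    the hypothesis on eta. *)
Lemma no_periodic_sweeps (T : eqType) (L : seq T) (c : T -> T -> nat)
    (before : rel T) (y : nat -> T -> rat) (a b : nat) (eta : T -> nat) :
  (a < b)%N -> (forall t i, 0 < y t i) -> y a =1 y b ->
  (forall t, {in L, forall k, y t.+1 k * y t k = 1 + \prod_(i <- L)
     (if before i k then y t.+1 i else y t i) ^+ c i k}) ->
  {in L, forall j, (2 * eta j <= \sum_(i <- L) c j i * eta i)%N} ->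
  {in L, forall i, eta i = 0%N}.
Proof.
move=> ab y_gt0 yab exch etaP k0 k0L; apply/eqP; rewrite -leqn0 leqNgt.
apply/negP => eta_gt0.
pose G i := \prod_(a <= t < b) y t i.
have G_gt0 i : 0 < G i by apply: prodr_gt0.
(* Periodicity enters here: a shift of the period permutes its factors. *)
have GS i : \prod_(a <= t < b) y t.+1 i = G i.
  apply: (mulfI (lt0r_neq0 (y_gt0 a i))).
  rewrite -(big_add1 _ _ a b.+1 xpredT (y ^~ i)) -big_ltn ?ltnS ?(ltnW ab) //.
  by rewrite big_nat_recr ?(ltnW ab) //= mulrC yab.
pose Z t k := \prod_(i <- L) (if before i k then y t.+1 i else y t i) ^+ c i k.
have Z_gt0 t k : 0 < Z t k.
  by apply: prodr_gt0 => i _; rewrite exprn_gt0 //; case: ifP.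
have G2 k : k \in L -> G k ^+ 2 = \prod_(a <= t < b) (1 + Z t k).
  move=> kL; rewrite expr2 -{1}GS -big_split /=.
  by apply: eq_bigr => t _; rewrite exch.
have ZG k : \prod_(a <= t < b) Z t k = \prod_(i <- L) G i ^+ c i k.
  rewrite exchange_big /=; apply: eq_bigr => i _; rewrite prodrXl.
  by case: (before i k); rewrite ?GS.
have GZ k : k \in L -> \prod_(i <- L) G i ^+ c i k < G k ^+ 2.
  move=> kL; rewrite G2 // -ZG; apply: ltr_prod_nat => // t _.
  by rewrite ltW //= ltrDr ltr01.
have G_gt1 k : k \in L -> 1 < G k.
  move=> kL; rewrite -(@expr_gt1 _ 2) ?ltW // G2 //.
  apply: le_lt_trans (ltr_prod_nat (E1 := fun=> 1) ab _); first by rewrite big1_eq.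
  by move=> t _; rewrite ler01 ltrDl Z_gt0.
have : \prod_(k <- L) (\prod_(i <- L) G i ^+ c i k) ^+ eta k <
       \prod_(k <- L) (G k ^+ 2) ^+ eta k.
  (* Only indices with eta > 0 give a strict inequality. *)
  have supp (u : T -> rat) : \prod_(k <- L) u k ^+ eta k =
      \prod_(k <- L | (k \in L) && (0 < eta k)%N) u k ^+ eta k.
    rewrite -big_seq_cond [RHS]big_mkcond; apply: eq_bigr => k _.
    by case: posnP => // ->; rewrite expr0.
  rewrite !supp; apply: ltr_prod => [|k /andP[kL eta_k]].
    by apply/hasP; exists k0 => //; rewrite k0L.
  have pos : 0 <= \prod_(i <- L) G i ^+ c i k.
    by apply: prodr_ge0 => i _; rewrite exprn_ge0 // ltW.
  by rewrite exprn_ge0 // ltrXn2r -?lt0n ?GZ.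
apply/negP; rewrite -leNgt.
rewrite [X in _ <= X](eq_bigr (fun k => \prod_(i <- L) G i ^+ (c i k * eta k)));
    last first.
  by move=> k _; under [RHS]eq_bigr do rewrite exprM; rewrite prodrXl.
rewrite [X in _ <= X]exchange_big /= big_seq [X in _ <= X]big_seq; apply: ler_prod => k kL.
rewrite !exprn_ge0 ?(ltW (G_gt0 k)) //= -exprM.
rewrite prodrXr; apply: ler_weXn2l; [exact: ltW (G_gt1 k kL)|exact: etaP].
Qed.

(** * Sign-skew-symmetric matrices and their mutations *)

(** The correction term is nonzero only along a path i -> k -> j or j -> k -> i. *)
Lemma matrix_mutationE n (B : 'I_n -> 'I_n -> int) k i j :
  i != k -> j != k ->
  matrix_mutation B k i j =
    if (0 <= B i k) && (0 <= B k j) then B i j + B i k * B k j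
    else if (B i k <= 0) && (B k j <= 0) then B i j - B i k * B k j
    else B i j.
Proof.
move=> /negPf ik /negPf jk; rewrite /matrix_mutation ik jk /=.
have half (x : int) : ((x + x) %/ 2)%Z = x.
  by rewrite -mulr2n -[_ *+ 2]mulr_natr mulzK.
case: (ger0P (B i k)) => [h1|h1]; case: (ger0P (B k j)) => [h2|h2] /=.
- by rewrite half.
- rewrite mulrN subrr div0z addr0; case: (lerP (B i k) 0) => //= h3.
  have -> : B i k = 0 by apply/eqP; rewrite eq_le h3.
  by rewrite (ltW h2) mul0r subr0.
- rewrite mulNr addNr div0z addr0 (ltW h1) /=; case: (lerP (B k j) 0) => //= h3.
  have -> : B k j = 0 by apply/eqP; rewrite eq_le h3.
  by rewrite mulr0 subr0.
- by rewrite (ltW h1) (ltW h2) /= mulNr mulrN half.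
Qed.

Section SignSkewSymmetric.
Variables (n : nat) (B : 'I_n -> 'I_n -> int).
Hypothesis sssB : sign_skew_symmetric B.

Lemma sss_gt0 i j : (0 < B i j) = (B j i < 0).
Proof. by case: (sssB i j) => [[-> ->]|]; rewrite ?ltxx //; nia. Qed.

Lemma sss_eq0 i j : (B i j == 0) = (B j i == 0).
Proof. by case: (sssB i j) => [[-> ->]|] //; nia. Qed.

Lemma sss_ge0 i j : (0 <= B i j) = (B j i <= 0).
Proof. by rewrite !le_eqVlt sss_gt0 eq_sym sss_eq0. Qed.

Lemma sss_diag i : B i i = 0.
Proof. by case: (sssB i i) => [[]|] //; nia. Qed.

End SignSkewSymmetric.

(** * Positive values of cluster variables *)

Section Specialization.
Variables (P : semifieldType).

Definition augmentation (g : gring P) : int :=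
  \sum_(p <- monalg.msupp g) monalg.mcoeff p g.

Lemma augmentationEw (d : {fset P}) (g : gring P) :
  (monalg.msupp g `<=` d)%fset ->
  augmentation g = \sum_(p <- d) monalg.mcoeff p g.
Proof.
by move=> gd; apply: big_fset_incl => // p _; apply: monalg.mcoeff_outdom.
Qed.

Lemma augmentation_is_zmod_morphism : zmod_morphism augmentation.
Proof.
move=> g1 g2; pose d := (monalg.msupp g1 `|` monalg.msupp g2)%fset.
rewrite !(augmentationEw (d := d)) ?fsubsetUl ?fsubsetUr ?monalg.msuppB_le //.
by rewrite -sumrB; apply: eq_bigr => p _; rewrite monalg.mcoeffB.
Qed.

HB.instance Definition _ :=
  GRing.isZmodMorphism.Build (gring P) int augmentation
    augmentation_is_zmod_morphism.

Lemma augmentationU c p : augmentation (monalg.mkmalgU p c) = c.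
Proof.
rewrite (augmentationEw (d := [fset p]%fset)) ?monalg.msuppU_le //.
by rewrite big_seq_fset1 monalg.mcoeffUU.
Qed.

Lemma augmentation_is_monoid_morphism : monoid_morphism augmentation.
Proof.
split=> [|g1 g2]; first exact: augmentationU.
rewrite [g1 * g2]/(gmul g1 g2) /gmul.
have E I r (G : I -> gring P) :
    augmentation (\sum_(i <- r) G i) = \sum_(i <- r) augmentation (G i).
  exact: raddf_sum.
rewrite E [augmentation g1]/augmentation mulr_suml; apply: eq_bigr => p _.
rewrite E [augmentation g2]/augmentation mulr_sumr; apply: eq_bigr => q _.
exact: augmentationU.
Qed.

HB.instance Definition _ :=
  GRing.isMonoidMorphism.Build (gring P) int augmentation
    augmentation_is_monoid_morphism.

End Specialization.

Section PositiveValues.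
Variables (P : semifieldType) (n : nat) (F : ambient P n) (S0 : seed F).

(** All variables and all elements of the semifield are sent to 1. *)
Definition value_at1 : {rmorphism {mpoly (gring P)[n]} -> int} :=
  meval (fun=> 1) \o map_mpoly (@augmentation P).

Definition in_cluster : {rmorphism {mpoly (gring P)[n]} -> F} :=
  meval (fun i : 'I_n => (cluster S0 : seq F)`_i)
    \o map_mpoly (scal F).

(** The ambient field is a field of fractions of polynomials over the group ring. *)
Lemma scal_inj : injective (scal F).
Proof.
have [phi [bij phiE]] := ambientP F.
move=> a b; rewrite -!phiE => /(bij_inj bij)/eqP.
rewrite -subr_eq0 -raddfB /= -mpolyCB tofrac_eq0.
by rewrite mpolyC_eq0 subr_eq0 => /eqP.
Qed.

(** Algebraic independence of the cluster over the fractions of the group ring. *)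
Lemma in_cluster_eq0 f : in_cluster f = 0 -> f = 0.
Proof.
have [indep _] := seed_basis S0.
move=> /indep f0; apply/mpolyP => m; rewrite mcoeff0.
apply: scal_inj; rewrite raddf0 -mcoeff_map_mpoly f0 ?mcoeff0 //.
move=> m'; rewrite mcoeff_map_mpoly; exists (mcoeff m' f), 1.
by rewrite rmorph1 divr1.
Qed.

(** The elements with a positive value form part of the local ring at the kernel of
    [value_at1].  Positivity is required of the numerator and of the denominator
    separately, so that sums, as well as products and quotients, have a value. *)
Definition has_value (u : F) (q : rat) : Prop :=
  exists f g, [/\ 0 < value_at1 f, 0 < value_at1 g,
    u * in_cluster g = in_cluster f & q = (value_at1 f)%:~R / (value_at1 g)%:~R].

Lemma has_value_gt0 u q : has_value u q -> 0 < q.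
Proof. by case=> f [g [f0 g0 _ ->]]; rewrite divr_gt0 ?ltr0z. Qed.

Lemma has_value_uniq u q r : has_value u q -> has_value u r -> q = r.
Proof.
case=> f [g [f0 g0 ufg ->]] [f' [g' [f'0 g'0 ufg' ->]]].
have fg : f * g' = f' * g.
  apply/eqP; rewrite -subr_eq0; apply/eqP/in_cluster_eq0.
  by rewrite rmorphB !rmorphM -ufg -ufg' mulrAC subrr.
apply/eqP; rewrite eqr_div ?intr_eq0 ?(gt_eqF g0) ?(gt_eqF g'0) //.
by rewrite -!intrM -!rmorphM fg.
Qed.

Lemma has_valueM u v q r :
  has_value u q -> has_value v r -> has_value (u * v) (q * r).
Proof.
case=> f [g [f0 g0 ufg ->]] [f' [g' [f'0 g'0 ufg' ->]]].
exists (f * f'), (g * g'); rewrite !rmorphM !mulr_gt0 //; split=> //.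
  by rewrite -ufg -ufg' mulrACA.
by rewrite invfM mulrACA.
Qed.

Lemma has_valueD u v q r :
  has_value u q -> has_value v r -> has_value (u + v) (q + r).
Proof.
case=> f [g [f0 g0 ufg ->]] [f' [g' [f'0 g'0 ufg' ->]]].
exists (f * g' + f' * g), (g * g'); split.
- by rewrite rmorphD !rmorphM addr_gt0 ?mulr_gt0.
- by rewrite rmorphM mulr_gt0.
- by rewrite rmorphD !rmorphM -ufg -ufg'; ring.
by rewrite rmorphD !rmorphM intrD !intrM addf_div ?intr_eq0 ?(gt_eqF g0) ?(gt_eqF g'0) //.
Qed.

Lemma has_value_div u v w q r :
  v * w = u -> has_value u q -> has_value v r -> has_value w (q / r).
Proof.
move=> vwu [f [g [f0 g0 ufg ->]]] [f' [g' [f'0 g'0 ufg' ->]]].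
exists (f * g'), (g * f'); split.
- by rewrite rmorphM mulr_gt0.
- by rewrite rmorphM mulr_gt0.
- by rewrite !rmorphM -ufg -ufg' -vwu; ring.
by rewrite !rmorphM !invfM invrK; ring.
Qed.

Lemma has_value1 : has_value 1 1.
Proof. by exists 1, 1; rewrite !rmorph1 divr1 mulr1. Qed.

Lemma has_valueX u q m : has_value u q -> has_value (u ^+ m) (q ^+ m).
Proof.
move=> uq; elim: m => [|m IH]; first by rewrite !expr0; exact: has_value1.
by rewrite !exprS; apply: has_valueM.
Qed.

Lemma has_value_prod (I : Type) (s : seq I) (Q : pred I) u q :
  (forall i, has_value (u i) (q i)) ->
  has_value (\prod_(i <- s | Q i) u i) (\prod_(i <- s | Q i) q i).
Proof.
by move=> uq; apply: big_ind2 => //; [exact: has_value1|by move=> *; apply: has_valueM].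
Qed.

Lemma has_value_coef p : has_value (coef F p) 1.
Proof.
exists (mpolyC n (gelt p)), 1; rewrite !rmorph1 divr1 mulr1.
have -> : value_at1 (mpolyC n (gelt p)) = 1.
  by rewrite /value_at1 /= map_mpolyC ?mevalC ?raddf0 //; exact: augmentationU.
split=> //.
by rewrite /in_cluster /= map_mpolyC ?mevalC ?raddf0.
Qed.

Lemma has_value_cluster z : z \in cluster S0 -> has_value z 1.
Proof.
move=> zS; have iz : (index z (cluster S0 : seq F) < n)%N.
  by rewrite -[X in (_ < X)%N](seed_card S0) index_mem.
exists (mpolyX _ (mnm1 (Ordinal iz))), 1.
rewrite !rmorph1 divr1 mulr1.
have -> : value_at1 (mpolyX _ (mnm1 (Ordinal iz))) = 1.
  by rewrite /value_at1 /= map_mpolyX mevalXU.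
split=> //.
by rewrite /in_cluster /= map_mpolyX mevalXU nth_index.
Qed.

End PositiveValues.

(** * Labelled seeds and sweeps *)

Section Growth.
Variables (P : semifieldType) (n : nat) (A : cluster_algebra P n).
Let F := ca_field A.
Implicit Types (x : 'I_n -> F) (B : 'I_n -> 'I_n -> int) (v : 'I_n -> rat).

Definition labelled_seed x B : Prop :=
  exists S, [/\ seeds A S, injective x, cluster S = [fset x i | i : 'I_n]%fset
    & forall i j, bentry S (x i) (x j) = B i j].

Lemma labelled_seed_sss x B : labelled_seed x B -> sign_skew_symmetric B.
Proof. by case=> S [_ _ _ BE] i j; rewrite -!BE; apply: (seed_sss S). Qed.

Lemma cluster_big (R : Type) (idx : R) (op : Monoid.com_law idx) x
    (X : {fset F}) (Q : pred F) (G : F -> R) :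
  injective x -> X = [fset x i | i : 'I_n]%fset ->
  \big[op/idx]_(y <- X | Q y) G y = \big[op/idx]_(i | Q (x i)) G (x i).
Proof.
move=> x_inj XE; rewrite -(big_map x Q G); apply: perm_big.
apply: uniq_perm; rewrite ?fset_uniq ?map_inj_uniq ?index_enum_uniq // => y.
rewrite XE; apply/imfsetP/mapP => -[i _ ->]; exists i => //.
exact: mem_index_enum.
Qed.

(** In the labelling, the new variable inherits the index of the old one.  It does not
    belong to the rest of the cluster because both clusters have n elements. *)
Lemma labelled_seed_mutation x B k : labelled_seed x B ->
  exists x' (p q : P), [/\ labelled_seed x' (matrix_mutation B k),
    forall j, j != k -> x' j = x j
    & x k * x' k =
        coef F p * \prod_(i | 0 < B i k) x i ^+ `|B i k|%N +
        coef F q * \prod_(i | B i k < 0) x i ^+ `|B i k|%N].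
Proof.
case=> S [SA x_inj clS BE].
have xk : x k \in cluster S by rewrite clS; apply: in_imfset.
have [S' S'A [_ [z [exch clS' _ BE']]]] := seeds_mutation SA xk.
have zN : z \notin (cluster S `\ x k)%fset.
  apply/negP => zin; have := seed_card S'; have := seed_card S.
  rewrite clS' (cardfsD1 (x k)) xk /= cardfsU1 zin /= => e1 e2.
  by have /eqP := etrans e1 (esym e2); rewrite eqn_add2r.
pose x' i := if i == k then z else x i.
have x'N i : i != k -> x i != z.
  move=> ik; apply: contraNneq zN => <-; rewrite !inE (inj_eq x_inj) ik /=.
  by rewrite clS; apply: in_imfset.
have mem' y : (y \in cluster S') = (y \in [fset x' i | i : 'I_n]%fset).
  rewrite clS' !inE; apply/idP/imfsetP => /= [/predU1P[->|/andP[yk]]|[i _ ->]].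
  - by exists k; rewrite /x' ?eqxx.
  - rewrite clS => /imfsetP[i _ yE]; exists i => //; rewrite /x' yE.
    by case: eqP => // ik; rewrite yE ik eqxx in yk.
  - rewrite /x'; have [_|ik] := eqVneq i k; first by rewrite eqxx.
    by rewrite (inj_eq x_inj) ik clS in_imfset ?orbT.
exists x', (pplus S (x k)), (pminus S (x k)); split.
- exists S'; split=> //.
  + move=> i j; rewrite /x'; case: eqP => [->|/eqP ik]; case: eqP => [->|/eqP jk] //.
    * by move/esym/eqP; rewrite (negPf (x'N _ jk)).
    * by move/eqP; rewrite (negPf (x'N _ ik)).
    * exact: x_inj.
  + exact/fsetP.
  + move=> i j; have x'S l : x' l \in cluster S' by rewrite mem' in_imfset.
    have oldE l : (if x' l == z then x k else x' l) = x l.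
      rewrite /x'; case: (eqVneq l k) => [->|lk]; first by rewrite eqxx.
      by rewrite (negPf (x'N _ lk)).
    rewrite BE' // !oldE /matrix_mutation !(inj_eq x_inj) !BE //.
- by move=> j /negPf jk; rewrite /x' jk.
rewrite /x' eqxx [LHS]exch; congr (_ * _ + _ * _);
  by rewrite (cluster_big _ _ _ x_inj clS); apply: eq_big => [i|i _]; rewrite BE.
Qed.

Variable S0 : seed F.

(** [S0] is the seed at which values are taken; [x] need not label its cluster. *)
Definition valued_seed x B v : Prop :=
  labelled_seed x B /\ forall i, has_value S0 (x i) (v i).

Lemma valued_seed_mutation x B v k : valued_seed x B v ->
  exists x' v', [/\ valued_seed x' (matrix_mutation B k) v',
    forall j, j != k -> v' j = v j
    & v' k * v k = \prod_(i | 0 < B i k) v i ^+ `|B i k|%N +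
                   \prod_(i | B i k < 0) v i ^+ `|B i k|%N].
Proof.
case=> lab xv; have [x' [p [q [lab' x'E exch]]]] := labelled_seed_mutation k lab.
pose w := \prod_(i | 0 < B i k) v i ^+ `|B i k|%N +
          \prod_(i | B i k < 0) v i ^+ `|B i k|%N.
exists x', (fun i => if i == k then w / v k else v i); split.
- split=> // i; case: (eqVneq i k) => [->|ik]; last by rewrite x'E.
  apply: has_value_div exch _ (xv k).
  have -> : w = 1 * \prod_(i | 0 < B i k) v i ^+ `|B i k|%N +
                1 * \prod_(i | B i k < 0) v i ^+ `|B i k|%N by rewrite !mul1r.
  by apply: has_valueD; apply: has_valueM; try exact: has_value_coef;
    apply: has_value_prod => i0; apply: has_valueX.
- by move=> j /negPf ->.
by rewrite eqxx divfK // gt_eqF // (has_value_gt0 (xv k)).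
Qed.

(** A sweep stopped after m mutations.  The edges of [L] between mutated and other
    vertices are reversed, so the next vertex k of the order is a source of [L]:
    the arrows which entered k came from vertices already mutated.  At a source the correction
    terms of the matrix mutation vanish on [L], and one of the two exchange monomials
    involves no variable of [L]. *)
Lemma sweep_prefix x B v (L : seq 'I_n) m : uniq L ->
  {in L &, forall i j, 0 < B i j -> (index i L < index j L)%N} ->
  valued_seed x B v -> (forall i, i \notin L -> v i = 1) -> (m <= size L)%N ->
  exists x1 B1 v1, [/\ valued_seed x1 B1 v1,
    {in L &, forall i j, B1 i j =
       if (index i L < m)%N (+) (index j L < m)%N then - B i j else B i j},
    forall j, (j \notin L) || (m <= index j L)%N -> v1 j = v j
    & forall k, k \in L -> (index k L < m)%N ->
       v1 k * v k = 1 + \prod_(i <- L)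
         (if (index i L < index k L)%N then v1 i else v i) ^+ `|B i k|%N].
Proof.
move=> L_uniq acyc xBv v1off; have sssB := labelled_seed_sss xBv.1.
elim: m => [|m IH] m_lt; first by exists x, B, v; split.
have [x1 [B1 [v1 [xBv1 B1E v1E v1exch]]]] := IH (ltnW m_lt).
have sssB1 := labelled_seed_sss xBv1.1.
have k0 : 'I_n by case: L m_lt {L_uniq acyc v1off IH B1E v1E v1exch}.
pose k := nth k0 L m.
have kL : k \in L by rewrite mem_nth.
have ik : index k L = m by rewrite index_uniq.
(* The vertex k is a source of the current block. *)
have B1k i : i \in L -> B1 i k <= 0.
  move=> iL; rewrite B1E // ik ltnn addbF; case: ifP => im.
    rewrite oppr_le0 sss_ge0 // leNgt; apply/negP => /(acyc _ _ kL iL).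
    by rewrite ik ltnNge (ltnW im).
  by rewrite leNgt; apply/negP => /(acyc _ _ iL kL); rewrite ik im.
have kB1 j : j \in L -> 0 <= B1 k j by move=> jL; rewrite sss_ge0 // B1k.
have B1n i : i \in L -> `|B1 i k|%N = `|B i k|%N.
  by move=> iL; rewrite B1E //; case: ifP => // _; rewrite abszN.
have [x2 [v2 [xBv2 v2E v2exch]]] := valued_seed_mutation k xBv1.
have idxS i : i \in L -> (index i L < m.+1)%N = (index i L < m)%N || (i == k).
  move=> iL; rewrite ltnS leq_eqVlt orbC; congr (_ || _).
  apply/eqP/eqP => [im|->//]; rewrite -[i](nth_index k0 iL) im //.
exists x2, (matrix_mutation B1 k), v2; split=> //.
- move=> i j iL jL; rewrite !idxS //.
  have [->|nik] := eqVneq i k; have [->|njk] := eqVneq j k.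
  + by rewrite /matrix_mutation !eqxx /= !orbT addbb !sss_diag ?oppr0.
  + rewrite /matrix_mutation eqxx /= B1E // orbT orbF ik ltnn /=.
    by case: ifP; rewrite ?opprK.
  + rewrite /matrix_mutation eqxx orbT /= B1E // orbT orbF ik ltnn addbF addbT.
    by case: ifP; rewrite ?opprK.
  + rewrite !orbF -B1E // matrix_mutationE //.
    case: ifP => [/andP[h _]|_].
      have -> : B1 i k = 0 by apply/eqP; rewrite eq_le h B1k.
      by rewrite mul0r addr0.
    case: ifP => [/andP[_ h]|//].
    have -> : B1 k j = 0 by apply/eqP; rewrite eq_le h kB1.
    by rewrite mulr0 subr0.
- move=> j /orP[jL|jm]; rewrite v2E ?v1E ?jL //.
  + by apply: contraNneq jL => ->.
  + by rewrite (ltnW jm) orbT.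
  + by apply: contraTneq jm => ->; rewrite ik ltnn.
move=> k' k'L; rewrite idxS // => /orP[k'm|/eqP->{k' k'L}].
  have k'k : k' != k by apply: contraTneq k'm => ->; rewrite ik ltnn.
  rewrite v2E // v1exch //; congr (1 + _).
  apply: eq_big_seq => i iL; case: ifP => // ik'; rewrite v2E //.
  by apply: contraTneq ik' => ->; rewrite ik -leqNgt ltnW.
have vk : v1 k = v k by rewrite v1E // ik leqnn orbT.
have off i : i \notin L -> v1 i = 1 by move=> iL; rewrite v1E ?iL // v1off.
(* The first monomial contains only variables outside L, all of value 1. *)
rewrite -vk v2exch; congr (_ + _).
  apply: big1 => i; case: (boolP (i \in L)) => [iL|/off ->]; last by rewrite expr1n.
  by rewrite ltNge B1k.
rewrite (bigID (mem L)) /= [X in _ * X]big1 ?mulr1; last first.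
  by move=> i /andP[_ /off ->]; rewrite expr1n.
rewrite [RHS]big_uniq //= big_andbC big_mkcondr /=; apply: eq_bigr => i iL.
rewrite B1n // ik; have [iK|iK] := eqVneq i k.
  by rewrite iK sss_diag // sss_diag // ltxx.
have -> : (if (index i L < m)%N then v2 i else v i) = v1 i.
  by case: ifP => im; rewrite ?v2E // v1E // leqNgt im orbT.
case: ltrgt0P (B1k i iL) => // B0 _; rewrite -B1n // B0 expr0 //.
Qed.

End Growth.

(** * The growth obstruction *)

Lemma pigeonhole_seq (T : finType) (f : nat -> T) :
  exists a b, (a < b)%N /\ f a = f b.
Proof.
have /injectivePn[i [j ij fij]] : ~~ injectiveb (fun i : 'I_#|T|.+1 => f i).
  by apply/negP => /injectiveP/leq_card; rewrite card_ord ltnn.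
case: (ltngtP i j) => [lt_ij|lt_ji|/val_inj eq_ij].
- by exists i, j.
- by exists j, i.
- by rewrite eq_ij eqxx in ij.
Qed.

Section FiniteType.
Variables (P : semifieldType) (n : nat) (A : cluster_algebra P n).
Hypothesis finA : finite_type A.
Implicit Types (x : 'I_n -> ca_field A) (B : 'I_n -> 'I_n -> int).

(** Pigeonhole on labellings with values in the finite set of cluster variables. *)
Lemma finitely_many_labelled (xs : nat -> 'I_n -> ca_field A) :
  (forall t, exists B, labelled_seed (xs t) B) ->
  exists a b, (a < b)%N /\ xs a =1 xs b.
Proof.
move=> lab.
pose X := (\bigcup_(S in seeds A) [set` cluster S])%classic.
have : finite_set X.
  by apply: bigcup_finite => // S _; apply: finite_fset.
case/finite_seqP => V VE.
have xsV t i : xs t i \in V.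
  have [B [S [SA _ clS _]]] := lab t.
  have : X (xs t i).
    by exists S => //=; rewrite clS; apply: in_imfset.
  by rewrite VE.
have [a [b [ab]]] := pigeonhole_seq (fun t => [ffun i => SeqSub (xsV t i)]).
move/ffunP => fab; exists a, b; split=> // i.
by have := fab i; rewrite !ffunE => /(congr1 val).
Qed.

(** Sort I by h, sweep forever, and apply [no_periodic_sweeps] to the values taken
    at the cluster of the given seed. *)
Lemma growth x B (I : {set 'I_n}) (h eta : 'I_n -> nat) :
  labelled_seed x B ->
  {in I &, forall i j, 0 < B i j -> (h i < h j)%N} ->
  {in I, forall j, (2 * eta j <= \sum_(i in I) `|B j i| * eta i)%N} ->
  {in I, forall i, eta i = 0%N}.
Proof.
move=> lab acyc etaP.
have [S0 [_ _ clS0 _]] := lab.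
pose L := sort (relpre h leq) (enum I).
have memL i : (i \in L) = (i \in I) by rewrite mem_sort mem_enum.
have L_uniq : uniq L by rewrite sort_uniq enum_uniq.
have acycL : {in L &, forall i j, 0 < B i j -> (index i L < index j L)%N}.
  move=> i j iL jL Bij; rewrite ltnNge; apply/negP => le_ji.
  have leT_tr : transitive (relpre h leq) by move=> ? ? ? /=; apply: leq_trans.
  have L_sorted : sorted (relpre h leq) L.
    by apply: sort_sorted => ? ?; apply: leq_total.
  have /= := sorted_leq_index leT_tr (fun _ => leqnn _) L_sorted _ _ jL iL le_ji.
  by rewrite leqNgt acyc // -memL.
pose T := ('I_n -> ca_field A) * ('I_n -> 'I_n -> int) * ('I_n -> rat) : Type.
pose st (s : T) := [/\ valued_seed S0 s.1.1 s.1.2 s.2,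
  {in L &, forall i j, s.1.2 i j = B i j} & forall i, i \notin L -> s.2 i = 1].
have step (s : {s | st s}) : exists s' : {s | st s},
    {in L, forall k, (sval s').2 k * (sval s).2 k = 1 + \prod_(i <- L)
      (if (index i L < index k L)%N then (sval s').2 i else (sval s).2 i)
        ^+ `|B i k|%N}.
  case: s => -[[y C] v] /= [/= val_v CB v1].
  have acycC : {in L &, forall i j, 0 < C i j -> (index i L < index j L)%N}.
    by move=> i j iL jL; rewrite CB //; apply: acycL.
  have [y' [C' [v' [val' C'E v'E exch]]]] :=
    sweep_prefix L_uniq acycC val_v v1 (leqnn _).
  have st' : st (y', C', v').
    split=> //= [i j iL jL|i iL]; last by rewrite v'E ?iL // v1.
    by rewrite C'E // !index_mem iL jL CB.
  exists (exist st _ st') => k kL /=; rewrite exch ?index_mem //.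
  by congr (1 + _); apply: eq_big_seq => i iL; rewrite CB.
have [f fP] := choice step.
have st0 : st (x, B, fun=> 1).
  split=> //=; split=> //= i; apply: has_value_cluster.
  by rewrite clS0; apply: in_imfset.
pose s t := iter t f (exist st _ st0).
have sP t : st (sval (s t)) by case: (s t).
have [t|a [b [ab xab]]] := @finitely_many_labelled (fun t => (sval (s t)).1.1).
  by have [[lab_t _] _ _] := sP t; exists (sval (s t)).1.2.
move=> i iI; apply: (@no_periodic_sweeps _ L (fun i j => `|B i j|%N)
  (fun i k => (index i L < index k L)%N) (fun t => (sval (s t)).2) a b) => //.
- by move=> t j; have [[_ /(_ j)/has_value_gt0]] := sP t.
- move=> j; have [[_ va] _ _] := sP a; have [[_ vb] _ _] := sP b.
  by apply: has_value_uniq (va j) _; rewrite xab.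
- by move=> t; apply: fP.
- move=> j; rewrite memL => jI; apply: leq_trans (etaP j jI) _.
  by rewrite (big_uniq _ L_uniq) /=; under [leqRHS]eq_bigl do rewrite memL.
- by rewrite memL.
Qed.

End FiniteType.

(** * Cycles in a finite mutation class *)

Lemma next_neq_prev (T : eqType) (c : seq T) x :
  uniq c -> (2 < size c)%N -> x \in c -> next c x != prev c x.
Proof.
move=> c_uniq c_size /rot_to[i p cE]; rewrite -(size_rot i) in c_size.
rewrite -(next_rot i) // -(prev_rot i) //; rewrite -(rot_uniq i) in c_uniq.
move: c_uniq c_size; rewrite cE; case: p {cE} => [|y [|z q]] // c_uniq _.
have [xy xz] : x != y /\ x != z.
  by move: c_uniq; rewrite /= !inE !negb_or -!andbA => /and3P[].
have nx : next [:: x, y, z & q] x = y by rewrite /= eqxx.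
have ny : next [:: x, y, z & q] y = z by rewrite /= eq_sym (negPf xy) eqxx.
apply: contra_neq xz => prev_x.
by rewrite -[LHS](next_prev c_uniq) -prev_x nx ny.
Qed.

Definition mutation_sequence n (B : 'I_n -> 'I_n -> int) (L : seq 'I_n) :=
  foldl (@matrix_mutation 'I_n) B L.

Section FiniteMutationClass.
Variables (n : nat) (M : ('I_n -> 'I_n -> int) -> Prop).
Implicit Types (B : 'I_n -> 'I_n -> int) (I U W : {set 'I_n}) (eps : 'I_n -> bool).

(** [M] abstracts the set of exchange matrices of the labelled seeds. *)
Hypothesis M_mutation : forall B k, M B -> M (matrix_mutation B k).
Hypothesis M_sss : forall B, M B -> sign_skew_symmetric B.
Hypothesis M_growth : forall B (I : {set 'I_n}) (h eta : 'I_n -> nat), M B ->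
  {in I &, forall i j, 0 < B i j -> (h i < h j)%N} ->
  {in I, forall j, (2 * eta j <= \sum_(i in I) `|B j i| * eta i)%N} ->
  {in I, forall i, eta i = 0%N}.

Lemma M_mutation_sequence B L : M B -> M (mutation_sequence B L).
Proof. by elim: L B => //= k L IH B MB; apply/IH/M_mutation. Qed.

(** Every vertex of a cycle has two distinct neighbours on it, so eta = 1 violates
    the growth obstruction.  Chords only help. *)
Lemma cycle_not_acyclic B (c : seq 'I_n) (h : 'I_n -> nat) :
  M B -> uniq c -> (2 < size c)%N -> cycle (fun x y => B x y != 0) c ->
  ~ {in c &, forall x y, 0 < B x y -> (h x < h y)%N}.
Proof.
move=> MB c_uniq c_size c_cycle acyc.
pose I := [set x in c].
have [x xc] : exists x, x \in c.
  by case: c c_size {c_uniq c_cycle acyc I} => // x c _; exists x; rewrite mem_head.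
suff /(_ x) : {in I, forall i : 'I_n, 1%N = 0%N} by rewrite inE xc => /(_ isT).
apply: (M_growth (h := h) MB).
  by move=> i j; rewrite !inE; apply: acyc.
move=> j; rewrite inE => jc.
have edge i : B j i != 0 -> (0 < `|B j i|)%N by rewrite absz_gt0.
rewrite (bigD1 (next c j)) ?inE ?mem_next //=.
rewrite (bigD1 (prev c j)) /= ?inE ?mem_prev ?jc /=; last first.
  by rewrite eq_sym next_neq_prev.
have := edge _ (next_cycle c_cycle jc).
have := edge (prev c j); rewrite (sss_eq0 (M_sss MB)).
move=> /(_ (prev_cycle c_cycle jc)); lia.
Qed.

(** [eps] selects the sources; isolated vertices may be given either sign. *)
Definition bipartite B W eps : Prop :=
  {in W &, forall x y, 0 < B x y -> eps x && ~~ eps y}.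

Definition graph_on B W : rel 'I_n :=
  fun x y => [&& x \in W, y \in W & B x y != 0].

Definition connected_on B W : Prop :=
  {in W &, forall x y, connect (graph_on B W) x y}.

Lemma graph_on_path_sub B W x p :
  x \in W -> path (graph_on B W) x p -> {subset x :: p <= W}.
Proof.
elim: p x => [|y p IH] x xW /= => [_ z|]; first by rewrite inE => /eqP->.
case/andP => /and3P[_ yW _] p_path z; rewrite inE => /predU1P[->//|].
exact: IH p_path z.
Qed.

Section Bipartite.
Variables (B : 'I_n -> 'I_n -> int) (W : {set 'I_n}) (eps : 'I_n -> bool).
Hypotheses (MB : M B) (bipW : bipartite B W eps).
Let sssB := M_sss MB.

Lemma bipartite_source x y : x \in W -> y \in W -> eps x -> 0 <= B x y.
Proof.
move=> xW yW ex; rewrite leNgt -sss_gt0 //; apply/negP => /(bipW yW xW).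
by rewrite ex andbF.
Qed.

Lemma bipartite_sink x y : x \in W -> y \in W -> ~~ eps x -> B x y <= 0.
Proof.
by move=> xW yW ex; rewrite leNgt; apply/negP => /(bipW xW yW); rewrite (negPf ex).
Qed.

Lemma bipartite_same x y : x \in W -> y \in W -> eps x = eps y -> B x y = 0.
Proof.
move=> xW yW exy; apply/eqP; rewrite eq_le; case: (boolP (eps x)) => ex.
  by rewrite -sss_ge0 // !bipartite_source // -exy.
by rewrite bipartite_sink // sss_ge0 // bipartite_sink // -exy.
Qed.

Hypothesis connW : connected_on B W.
Variable v : 'I_n.
Hypothesis vW : v \notin W.

(** Otherwise, follow a path in W from i up to the first other neighbour k of v.
    Together with v it forms a cycle on which the neighbours i and k of v are not
    adjacent, and since W is bipartite such a cycle is acyclically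
    oriented. *)
Lemma two_neighbours_adjacent i j : i \in W -> j \in W -> i != j ->
  B i v != 0 -> B j v != 0 ->
  exists k, [/\ k \in W, B k v != 0 & B i k != 0].
Proof.
move=> iW jW ij Biv Bjv.
have [[k /and3P[? ? ?]]|/existsPn nadj] :=
  altP (@existsP _ (fun k => [&& k \in W, B k v != 0 & B i k != 0])); first by exists k.
have adj0 k : k \in W -> B k v != 0 -> B i k = 0.
  by move=> kW Bkv; have := nadj k; rewrite kW Bkv negbK => /eqP.
have /connectP[p0 p0_path] := connW iW jW.
case: (shortenP p0_path) => p p_path p_uniq _ jE {p0 p0_path}.
pose a k := B k v != 0.
have : has a p.
  apply/hasP; exists j => //; case: p jE {p_path p_uniq} => [/= ji|y p ->].
    by rewrite ji eqxx in ij.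
  by rewrite /= mem_last.
move=> hp; case: (split_find hp) p_path p_uniq => k s1 s2 ak nas1.
rewrite cat_path -cat_cons cat_uniq => /andP[p_path _] /andP[p_uniq _].
have pW : {subset i :: rcons s1 k <= W} by apply: graph_on_path_sub p_path.
(* Sources come first and sinks last, except that the neighbours of v are moved
   next to v, on the side given by their edge; this is consistent because i and
   k are not adjacent. *)
pose h x := if x == v then 2%N else
  if 0 < B v x then 3%N else if B v x < 0 then 1%N else if eps x then 0%N else 4%N.
pose c := v :: i :: rcons s1 k.
exfalso; apply: (@cycle_not_acyclic B c h) => //.
- by rewrite cons_uniq p_uniq andbT; apply: contra vW; apply: pW.
- by rewrite /= size_rcons.
- rewrite /= sss_eq0 // Biv rcons_path last_rcons -/(a k) ak andbT.
  by apply: sub_path p_path => x y /and3P[].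
have kW : k \in W by apply: pW; rewrite inE mem_rcons mem_head orbT.
have nbr x : x \in i :: rcons s1 k -> (x == i) || (x == k) || (B v x == 0).
  rewrite inE mem_rcons inE => /or3P[->|->|xs1]; rewrite ?orbT // sss_eq0 //.
  by move/hasPn: nas1 => /(_ x xs1); rewrite negbK => ->; rewrite orbT.
have Bik : B i k = 0 by apply: adj0.
have Bki : B k i = 0 by apply/eqP; rewrite sss_eq0 // Bik.
have Bii z : B z z = 0 by apply: sss_diag.
move=> x y; rewrite ![_ \in c]inE => /predU1P[->|xc] /predU1P[->|yc].
- by rewrite Bii ltxx.
- have /negPf yv : y != v by apply: contraNneq vW => <-; apply: pW.
  by rewrite /h eqxx yv => ->.
- have /negPf xv : x != v by apply: contraNneq vW => <-; apply: pW.
  rewrite /h eqxx xv sss_gt0 // => vx0; rewrite vx0.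
  by rewrite ltNge ltW.
have /negPf xv : x != v by apply: contraNneq vW => <-; apply: pW.
have /negPf yv : y != v by apply: contraNneq vW => <-; apply: pW.
move=> Bxy; have /andP[ex ey] := bipW (pW _ xc) (pW _ yc) Bxy.
rewrite /h xv yv ex (negPf ey).
have := nbr x xc; have := nbr y yc.
case: (eqVneq (B v y) 0) => [->|nvy]; case: (eqVneq (B v x) 0) => [->|nvx];
  rewrite ?ltxx //.
- by case: ltgtP nvx => //.
- by case: ltgtP nvy => //.
rewrite !orbF => /orP[]/eqP yE /orP[]/eqP xE; move: Bxy;
  by rewrite xE yE ?Bii ?Bik ?Bki ltxx.
Qed.

(** The triangle formed by v, i and an adjacent neighbour k of v cannot be acyclic,
    so it is v -> source -> sink -> v. *)
Lemma two_neighbours_orientation i j : i \in W -> j \in W -> i != j ->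
  B i v != 0 -> B j v != 0 -> if eps i then B i v < 0 else 0 < B i v.
Proof.
move=> iW jW ij Biv Bjv.
have [k [kW Bkv Bik]] := two_neighbours_adjacent iW jW ij Biv Bjv.
have iv : i != v by apply: contraNneq vW => <-.
have kv : k != v by apply: contraNneq vW => <-.
have ik : i != k by apply: contraNneq Bik => ->; rewrite sss_diag.
have eik : eps i != eps k.
  by apply: contra_neq Bik => e; apply: bipartite_same.
have := @cycle_not_acyclic B [:: v; i; k] _ MB.
rewrite /= !inE negb_or eq_sym iv eq_sym kv ik Bik Bkv sss_eq0 // Biv.
move=> /(_ _ isT isT isT) tri.
have Bd z : B z z = 0 by apply: sss_diag.
have Bn x y : B x y < 0 -> 0 < B x y -> false by case: ltgtP.
case: ifP => ei; rewrite ltNge; apply/negP => Biv0.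
  have {Biv0}Biv1 : 0 < B i v by rewrite lt_neqAle eq_sym Biv.
  have Bik1 : 0 < B i k by rewrite lt_neqAle eq_sym Bik bipartite_source.
  have Bki : B k i < 0 by rewrite -sss_gt0.
  have Bvi : B v i < 0 by rewrite -sss_gt0.
  apply: (tri (fun z => if z == i then 0%N else
    if (z == k) == (0 < B k v) then 1%N else 2%N)) => x y.
  rewrite !inE => /or3P[]/eqP-> /or3P[]/eqP->; rewrite ?Bd ?ltxx ?eqxx //=;
    rewrite ?(negPf iv) ?(negPf kv) ?(eq_sym _ i) ?(negPf ik) ?(eq_sym v) ?(negPf iv) ?(negPf kv) //=.
  - by move/(Bn _ _ Bvi).
  - by rewrite sss_gt0 // => /ltW/le_gtF ->.
  - by case: ifP.
  - by case: ifP.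
  - by move=> ->.
  - by move/(Bn _ _ Bki).
have {Biv0}Biv1 : B i v < 0 by rewrite lt_neqAle Biv.
have Bik1 : B i k < 0 by rewrite lt_neqAle Bik bipartite_sink ?ei.
apply: (tri (fun z => if z == i then 2%N else
    if (z == k) == (0 < B k v) then 0%N else 1%N)) => x y.
rewrite !inE => /or3P[]/eqP-> /or3P[]/eqP->; rewrite ?Bd ?ltxx ?eqxx //=;
    rewrite ?(negPf iv) ?(negPf kv) ?(eq_sym _ i) ?(negPf ik) ?(eq_sym v) ?(negPf iv) ?(negPf kv) //=.
- by case: ifP.
- by rewrite sss_gt0 // => /ltW/le_gtF ->.
- by move/(Bn _ _ Biv1).
- by move/(Bn _ _ Bik1).
- by move=> ->.
- by case: ifP.
Qed.

End Bipartite.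

(** * Sweeping the sinks of a bipartite block *)

(** Distinct sinks are not adjacent, so the mutations do not interact: each one
    reverses the edges at its sink and adds to the entries joining the sources to v
    the contribution of the paths source -> sink -> v. *)
Lemma mutate_sinks B W eps v (L : seq 'I_n) :
  M B -> bipartite B W eps -> v \notin W -> uniq L -> {subset L <= W} ->
  {in L, forall k, ~~ eps k} ->
  {in W &, forall x y, mutation_sequence B L x y =
     if (x \in L) || (y \in L) then - B x y else B x y} /\
  {in W, forall x, mutation_sequence B L x v =
     if x \in L then - B x v
     else B x v + \sum_(k <- L) B x k * Num.max (B k v) 0}.
Proof.
move=> MB bipW vW; elim/last_ind: L => [|L k IH].
  by move=> _ _ _; split=> // x xW; rewrite big_nil addr0.
rewrite rcons_uniq => /andP[kL L_uniq] LW Lsink.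
have sub : {subset L <= rcons L k} by move=> z zL; rewrite mem_rcons inE zL orbT.
have kin : k \in rcons L k by rewrite mem_rcons mem_head.
have kW : k \in W by apply: LW.
have ek : eps k = false by apply/negbTE/Lsink.
have [] := IH L_uniq (fun z zL => LW z (sub z zL)) (fun z zL => Lsink z (sub z zL)).
rewrite /mutation_sequence foldl_rcons -/(mutation_sequence B L).
set C := mutation_sequence B L => CW Cv.
have Lk0 x : x \in L -> B x k = 0 /\ B k x = 0.
  move=> xL; have ex : eps x = false by apply/negbTE/Lsink/sub.
  by split; apply: (bipartite_same MB bipW); rewrite ?ex ?ek //; apply/LW/sub.
have Cxk x : x \in W -> C x k = B x k.
  move=> xW; rewrite CW // (negPf kL) orbF; case: ifP => // xL.
  by have [-> _] := Lk0 x xL; rewrite oppr0.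
have Cky y : y \in W -> C k y = B k y.
  move=> yW; rewrite CW // (negPf kL) /=; case: ifP => // yL.
  by have [_ ->] := Lk0 y yL; rewrite oppr0.
have Ckv : C k v = B k v.
  rewrite Cv // (negPf kL) big1_seq ?addr0 // => x /andP[_ xL].
  by have [_ ->] := Lk0 x xL; rewrite mul0r.
have Bxk x : x \in W -> 0 <= B x k.
  by move=> xW; rewrite (sss_ge0 (M_sss MB)) (bipartite_sink bipW) ?ek.
have Bkx x : x \in W -> B k x <= 0.
  by move=> xW; rewrite (bipartite_sink bipW) ?ek.
split=> [x y xW yW|x xW].
  have [->|xk] := eqVneq x k.
    by rewrite /matrix_mutation eqxx /= Cky // kin.
  have [->|yk] := eqVneq y k.
    by rewrite /matrix_mutation eqxx orbT /= Cxk // kin orbT.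
  rewrite !mem_rcons !inE (negPf xk) (negPf yk) /= -CW // matrix_mutationE //.
  rewrite Cxk // Cky // Bxk //= Bkx // andbT.
  case: ifP => [h|_]; last case: ifP => // h.
    have -> : B k y = 0 by apply/eqP; rewrite eq_le h Bkx.
    by rewrite mulr0 addr0.
  have -> : B x k = 0 by apply/eqP; rewrite eq_le h Bxk.
  by rewrite mul0r subr0.
have vk : v != k by apply: contraNneq vW => ->.
have [->|xk] := eqVneq x k.
  by rewrite /matrix_mutation eqxx /= Ckv kin.
rewrite matrix_mutationE // Cxk // Ckv Bxk //= Cv // mem_rcons inE (negPf xk) /=.
case: (boolP (x \in L)) => [xL|xL].
  by have [-> _] := Lk0 x xL; rewrite !mul0r addr0 !if_same.
rewrite -cats1 big_cat big_seq1 /= addrA.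
case: (lerP 0 (B k v)) => // h; rewrite mulr0 addr0; case: ifP => // /andP[h' _].
have -> : B x k = 0 by apply/eqP; rewrite eq_le h' Bxk.
by rewrite mul0r subr0.
Qed.

(** The first alternative of [Zmatrix_alternative], for the Cartan counterpart of the
    block, is excluded by the growth obstruction. *)
Lemma bipartite_weights B W eps : M B -> bipartite B W eps ->
  exists u : 'I_n -> int, (forall i, 0 < u i) /\
    {in W, forall k, \sum_(i in W) u i * `|B i k| < 2 * u k}.
Proof.
move=> MB bipW.
(* Extending the block by twice the identity outside W changes neither
   alternative. *)
pose A j i : int := if j == i then 2 else
  if (j \in W) && (i \in W) then - `|B j i| else 0.
have sumA (f g : 'I_n -> int) j : j \in W ->
    \sum_i A j i * f i = 2 * f j - \sum_(i in W) `|B j i| * f i /\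
    \sum_i g i * A i j = 2 * g j - \sum_(i in W) g i * `|B i j|.
  have Bjj : B j j = 0 by apply: sss_diag; apply: M_sss.
  move=> jW; split; rewrite (bigD1 j) //= {1}/A eqxx [in RHS](bigD1 j) //=;
    rewrite Bjj normr0 ?mul0r ?mulr0 add0r -sumrN ?[f j * _]mulrC ?[g j * 2]mulrC;
    congr (_ + _); rewrite big_andbC big_mkcondr; apply: eq_bigr => i ij /=.
    by rewrite /A eq_sym (negPf ij) jW /=; case: ifP; rewrite ?mulNr ?mul0r.
  by rewrite /A (negPf ij) jW andbT; case: ifP; rewrite ?mulrN ?mulr0.
have [|[eta [eta0 [k etak] etaA]]|[u [u0 uA]]] := @Zmatrix_alternative n A.
- by move=> i j /negPf ij; rewrite /A ij; case: ifP; rewrite // oppr_le0.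
- have etaW : {in W, forall i, `|eta i|%N = 0%N}.
    apply: (M_growth (h := fun i => ~~ eps i) MB) => [i j iW jW|j jW].
      by move/(bipW _ _ iW jW) => /andP[-> ->].
    have := etaA j; have [-> _] := sumA eta eta j jW; rewrite subr_le0.
    rewrite -lez_nat (big_morph Posz PoszD (erefl _)) PoszM gez0_abs //.
    move=> h; apply: le_trans h _; apply: ler_sum => i _.
    by rewrite PoszM !abszE [X in _ <= _ * X]ger0_norm.
  have kW : k \notin W by apply/negP => /etaW; lia.
  have := etaA k; rewrite (bigD1 k) //= big1 ?addr0 /A ?eqxx; first by lia.
  by move=> i /negPf; rewrite eq_sym => ->; rewrite (negPf kW) mul0r.
- exists u; split=> // k kW; have := uA k.
  by have [_ ->] := sumA u u k kW; rewrite subr_gt0.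
Qed.

(** * Reducing to a unique neighbour *)

Section UniqueNeighbour.
Variables (W : {set 'I_n}) (v : 'I_n) (u : 'I_n -> int).
Hypotheses (vW : v \notin W) (u_gt0 : forall i, 0 < u i).

(** What is preserved by the sweeps as long as v has two neighbours in W; [u] never
    changes because the absolute values of the entries on W do not. *)
Definition sweepable B eps : Prop :=
  [/\ M B, bipartite B W eps, connected_on B W,
     {in W, forall k, \sum_(i in W) u i * `|B i k| < 2 * u k}
   & exists2 i, i \in W & B i v != 0].

Definition source_potential B eps := \sum_(i in W | eps i) u i * - B i v.
Definition sink_potential B eps := \sum_(k in W | ~~ eps k) u k * B k v.

(** By [two_neighbours_orientation] both potentials are sums of nonnegative terms,
    and on the entries at v the sweep is linear.  The sinks become sources with the
    same potential b, and the new sink potential is at most 2 b - a - 1 when b > 0,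
    by the strict inequality satisfied by u. *)
Lemma sink_sweep B eps i j : sweepable B eps ->
  i \in W -> j \in W -> i != j -> B i v != 0 -> B j v != 0 ->
  let L := [seq k <- enum W | ~~ eps k] in
  let B' := mutation_sequence B L in
  let eps' := negb \o eps in
  [/\ sweepable B' eps', {in W &, forall x y, B' x y = - B x y},
      0 <= source_potential B eps /\ 0 <= sink_potential B eps,
      0 < source_potential B eps + sink_potential B eps
   & source_potential B' eps' = sink_potential B eps /\
     sink_potential B' eps' <= 2 * sink_potential B eps
       - source_potential B eps - (0 < sink_potential B eps)%R%:Z].
Proof.
move=> [MB bipW connW uB _] iW jW ij Biv Bjv L B' eps'.
have memL x : x \in W -> (x \in L) = ~~ eps x.
  by move=> xW; rewrite mem_filter mem_enum xW andbT.
have LW : {subset L <= W} by move=> x; rewrite mem_filter mem_enum => /andP[].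
have [] := mutate_sinks MB bipW vW (filter_uniq _ (enum_uniq W)) LW.
  by move=> x; rewrite mem_filter => /andP[].
rewrite -/L -/B' => B'W0 B'v0.
have B'W : {in W &, forall x y, B' x y = - B x y}.
  move=> x y xW yW; rewrite B'W0 // !memL // -negb_and; case: ifP => // /negbFE.
  by move=> /andP[ex ey]; rewrite (bipartite_same MB bipW) ?oppr0 ?ex ?ey.
have orient x : x \in W -> if eps x then B x v <= 0 else 0 <= B x v.
  move=> xW; have [->|Bxv] := eqVneq (B x v) 0; first by rewrite !lexx if_same.
  have [y [yW xy Byv]] : exists y, [/\ y \in W, x != y & B y v != 0].
    have [xi|xi] := eqVneq x i; last by exists i.
    by exists j; rewrite xi.
  have := two_neighbours_orientation MB bipW connW vW xW yW xy Bxv Byv.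
  by case: ifP => _ /ltW.
have B'src x : x \in W -> eps x ->
    B' x v = B x v + \sum_(k in W | ~~ eps k) B x k * B k v.
  move=> xW ex; rewrite B'v0 // memL // ex /=; congr (_ + _).
  rewrite big_filter_cond /= big_enum_cond /=; apply: eq_big => k.
    by rewrite andbT.
  by move=> /andP[kW /andP[ek _]]; rewrite max_l //; have := orient k kW; rewrite (negPf ek).
have B'snk k : k \in W -> ~~ eps k -> B' k v = - B k v.
  by move=> kW ek; rewrite B'v0 // memL // ek.
pose a := source_potential B eps; pose b := sink_potential B eps.
pose s := \sum_(k in W | ~~ eps k) B k v.
have Bk_ge0 k : (k \in W) && ~~ eps k -> 0 <= B k v.
  by move=> /andP[kW /negPf ek]; have := orient k kW; rewrite ek.
have a_ge0 : 0 <= a.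
  apply: sumr_ge0 => x /andP[xW ex]; rewrite mulr_ge0 ?oppr_ge0 ?(ltW (u_gt0 _)) //.
  by have := orient x xW; rewrite ex.
have b_ge0 : 0 <= b.
  by apply: sumr_ge0 => k kW; rewrite mulr_ge0 ?Bk_ge0 // (ltW (u_gt0 _)).
have s_ge0 : 0 <= s by apply: sumr_ge0.
have s0b : s = 0 -> b = 0.
  move=> s0; apply: big1 => k kW.
  have := psumr_eq0P (I := 'I_n) (P := fun k => (k \in W) && ~~ eps k) Bk_ge0 s0.
  by move=> ->; rewrite ?mulr0.
have b0 : b = 0 -> forall k, k \in W -> ~~ eps k -> B k v = 0.
  move=> b0 k kW ek.
  have : u k * B k v = 0.
    apply: (psumr_eq0P (I := 'I_n) (P := fun k => (k \in W) && ~~ eps k) _ b0).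
      by move=> l lW; rewrite mulr_ge0 ?Bk_ge0 // (ltW (u_gt0 _)).
    by rewrite kW.
  by move/eqP; rewrite mulf_eq0 gt_eqF ?u_gt0 // => /eqP.
have a0 : a = 0 -> forall x, x \in W -> eps x -> B x v = 0.
  move=> a0 x xW ex.
  have : u x * - B x v = 0.
    apply: (psumr_eq0P (I := 'I_n) (P := fun k => (k \in W) && eps k) _ a0).
      move=> l /andP[lW el]; rewrite mulr_ge0 ?oppr_ge0 ?(ltW (u_gt0 _)) //.
      by have := orient l lW; rewrite el.
    by rewrite xW.
  by move/eqP; rewrite mulf_eq0 gt_eqF ?u_gt0 //= oppr_eq0 => /eqP.
have ab0 : 0 < a \/ 0 < b.
  case: (ltrgt0P b) (b_ge0) => [|//|bE] _; first by right.
  case: (ltrgt0P a) (a_ge0) => [|//|aE] _; first by left.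
  case/eqP: Biv; case: (boolP (eps i)) => ei; [exact: a0|exact: b0].
split=> //.
- split.
  + exact: M_mutation_sequence.
  + move=> x y xW yW; rewrite B'W // oppr_gt0 -(sss_gt0 (M_sss MB)).
    by move/(bipW _ _ yW xW); rewrite /eps' /= negbK andbC.
  + move=> x y xW yW; have := connW _ _ xW yW; apply: connect_sub => {x y xW yW} x y.
    case/and3P=> xW yW Bxy; apply: connect1.
    by rewrite /graph_on xW yW B'W // oppr_eq0.
  + move=> k kW; have := uB k kW; congr (_ < _); apply: eq_bigr => x xW.
    by rewrite B'W // normrN.
  (* The sweep is invertible on the column of v, hence v keeps a neighbour. *)
  + have [/existsP[x /andP[xW Bxv]]|/existsPn none] :=
      boolP [exists x, (x \in W) && (B' x v != 0)]; first by exists x.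
    have B'0 x : x \in W -> B' x v = 0.
      by move=> xW; have := none x; rewrite xW negbK => /eqP.
    have Bk0 k : k \in W -> ~~ eps k -> B k v = 0.
      by move=> kW ek; apply/eqP; rewrite -oppr_eq0 -B'snk // B'0.
    case/eqP: Biv; case: (boolP (eps i)) => ei; last exact: Bk0.
    have := B'0 i iW; rewrite B'src // big1 ?addr0 // => k /andP[kW ek].
    by rewrite Bk0 // mulr0.
- by rewrite -/a -/b; case: ab0; lia.
split.
  apply: eq_bigr => k /andP[kW]; rewrite /eps' /= => ek.
  by rewrite B'snk // opprK.
have -> : sink_potential B' eps' =
    \sum_(k in W | ~~ eps k) B k v * (\sum_(x in W | eps x) u x * `|B x k|) - a.
  rewrite /a /source_potential -sumrN.
  rewrite (eq_bigr (fun k => \sum_(x in W | eps x) u x * (B x k * B k v))); last first.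
    move=> k /andP[kW ek]; rewrite mulr_sumr; apply: eq_bigr => x /andP[xW ex].
    rewrite ger0_norm; first by ring.
    by rewrite (bipartite_source MB bipW).
  rewrite exchange_big /= -big_split /=; apply: eq_big => [x|x].
    by rewrite /eps' /= negbK.
  rewrite /eps' /= negbK => /andP[xW ex]; rewrite B'src // mulrDr mulr_sumr addrC.
  by congr (_ + _); rewrite mulrN opprK.
have : \sum_(k in W | ~~ eps k) B k v * (\sum_(x in W | eps x) u x * `|B x k|)
    <= 2 * b - s.
  rewrite /b /s /sink_potential mulr_sumr -sumrB; apply: ler_sum => k /andP[kW ek].
  have Bkv := Bk_ge0 k; rewrite kW ek in Bkv.
  have uk : \sum_(x in W | eps x) u x * `|B x k| <= 2 * u k - 1.
    have := uB k kW; rewrite (bigID eps) /= [X in _ + X]big1 ?addr0; first by rewrite lerBrDr lezD1.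
    move=> x /andP[xW ex]; rewrite (bipartite_same MB bipW) ?normr0 ?mulr0 //.
    by rewrite (negPf ex) (negPf ek).
  have := ler_wpM2l (Bkv isT) uk; congr (_ <= _); ring.
rewrite -/a -/b; move: (\sum_(k in W | ~~ eps k) _) => X Xb.
(* As b > 0 is a combination of the terms of s, one of them is at least 1. *)
have : (0 < b)%R%:Z <= s.
  have [b_gt0|//] := boolP (0 < b).
  have : s != 0 by apply: contraTneq b_gt0 => /s0b ->; rewrite ltxx.
  by move: s_ge0; rewrite /=; lia.
lia.
Qed.

Definition has_unique_neighbour B : Prop := exists i,
  [/\ i \in W, B i v != 0 & {in W, forall j, j != i -> B j v = 0}].

Definition reaches_unique_neighbour B : Prop := exists L eps',
  let B' := mutation_sequence B L in
  [/\ {subset L <= W}, bipartite B' W eps',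
     {in W &, forall x y, `|B' x y| = `|B x y|} & has_unique_neighbour B'].

Lemma sink_sweep_or_unique B eps : sweepable B eps ->
  let B' := mutation_sequence B [seq k <- enum W | ~~ eps k] in
  let eps' := negb \o eps in
  let a := source_potential B eps in let b := sink_potential B eps in
  reaches_unique_neighbour B \/
  [/\ sweepable B' eps', reaches_unique_neighbour B' -> reaches_unique_neighbour B,
     0 <= a, 0 <= b
   & 0 < a + b /\ source_potential B' eps' = b /\
     sink_potential B' eps' <= 2 * b - a - (0 < b)%R%:Z].
Proof.
move=> st B' eps' a b; have [MB bipW _ _ [i iW Biv]] := st.
have [/existsP[j /and3P[jW ji Bjv]]|/existsPn none] :=
  boolP [exists j, [&& j \in W, j != i & B j v != 0]]; last first.
  left; exists [::], eps; split=> //; exists i; split=> // j jW ji.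
  by have := none j; rewrite jW ji negbK => /eqP.
right; rewrite eq_sym in ji.
have [st' B'W [a0 b0] ab0 [a' b']] := sink_sweep st iW jW ji Biv Bjv.
split=> // -[L [eps2 [LW bip2 abs2 uniq2]]].
exists ([seq k <- enum W | ~~ eps k] ++ L), eps2.
rewrite /mutation_sequence foldl_cat -!/(mutation_sequence _ _); split=> //.
  move=> k; rewrite mem_cat mem_filter mem_enum => /orP[/andP[]//|]; exact: LW.
by move=> x y xW yW; rewrite abs2 // /B' B'W // normrN.
Qed.

(** The difference b - a decreases at each sweep, so it becomes negative; from then
    on b itself decreases.  As b >= 0 while v has two neighbours in W, the process
    stops. *)
Lemma unique_neighbour_reachable B eps : sweepable B eps ->
  reaches_unique_neighbour B.
Proof.
pose a := source_potential; pose b := sink_potential.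
have decreasing (m : nat) : forall B eps, sweepable B eps ->
    b B eps - a B eps < 0 -> b B eps < m%:Z -> reaches_unique_neighbour B.
  elim: m => [|m IH] C e st D_lt0 b_lt;
    have [//|[st' back a0 b0 [ab0 [a' b']]]] := sink_sweep_or_unique st.
    by move: b_lt; rewrite /b ltNge b0.
  apply/back/(IH _ _ st'); rewrite /a /b ?a' in D_lt0 b_lt *; lia.
have main (m : nat) : forall B eps, sweepable B eps ->
    b B eps - a B eps < m%:Z -> reaches_unique_neighbour B.
  elim: m => [|m IH] C e st D_lt.
    by apply: (decreasing `|b C e|%N.+1 _ _ st) => //; lia.
  have [D_lt0|D_ge0] := ltrP (b C e - a C e) 0.
    by apply: (decreasing `|b C e|%N.+1 _ _ st) => //; lia.
  have [//|[st' back a0 b0 [ab0 [a' b']]]] := sink_sweep_or_unique st.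
  apply/back/(IH _ _ st'); rewrite /a /b a' in D_lt D_ge0 *.
  move: b' D_lt D_ge0; case: ltP => /=; lia.
move=> st; apply: (main `|b B eps - a B eps|%N.+1 _ _ st); lia.
Qed.

End UniqueNeighbour.

(** * Growing a bipartite symmetrizable block *)

Lemma mutation_sequence_isolated B U (L : seq 'I_n) : M B ->
  (forall x y, x \in U -> y \notin U -> B x y = 0) -> {in L, forall k, k \notin U} ->
  forall x y, (x \in U) || (y \in U) -> mutation_sequence B L x y = B x y.
Proof.
elim: L B => [|k L IH] B MB isoU LU x y xyU //=.
have kU : k \notin U by apply: LU; rewrite mem_head.
have kB z : z \in U -> B k z = 0.
  by move=> zU; apply/eqP; rewrite (sss_eq0 (M_sss MB)) isoU.
have mutU z w : (z \in U) || (w \in U) -> matrix_mutation B k z w = B z w.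
  rewrite /matrix_mutation => zwU; case: (eqVneq z k) zwU => [->|zk].
    by rewrite (negPf kU) /= => wU; rewrite kB ?oppr0.
  case: (eqVneq w k) => [->|wk] /=.
    by rewrite (negPf kU) orbF => zU; rewrite isoU ?oppr0.
  case/orP => [zU|wU].
    by rewrite (isoU z k) // normr0 !mul0r addr0.
  by rewrite (kB w) // normr0 !mulr0 addr0.
rewrite -[LHS]/(mutation_sequence (matrix_mutation B k) L x y) IH ?mutU //.
- exact: M_mutation.
- by move=> z w zU wU; rewrite mutU ?zU // isoU.
- by move=> z zL; apply: LU; rewrite inE zL orbT.
Qed.

Definition symmetrized B U (d : 'I_n -> int) : Prop :=
  (forall x, 0 < d x) /\ {in U &, forall x y, d x * `|B x y| = d y * `|B y x|}.

(** [U] is the set of vertices already treated and [W] the connected component being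
    built; the components already completed, [U :\: W], are isolated from all other
    vertices, so that later mutations do not affect them. *)
Definition grown B U W : Prop := exists eps d,
  [/\ M B /\ W \subset U, bipartite B U eps, symmetrized B U d, connected_on B W
    & forall x y, x \in U :\: W -> y \notin U :\: W -> B x y = 0].

(** If the edge between v and its only neighbour i has the wrong direction, the
    mutation at v reverses it and changes nothing else on [U].  The symmetrizer is
    rescaled on [U] to match the ratio of the two entries of the new edge. *)
Lemma attach_vertex B U W v i : grown B U W -> v \notin U -> i \in W ->
  B i v != 0 -> {in W, forall j, j != i -> B j v = 0} ->
  exists B', grown B' (v |: U) (v |: W).
Proof.
move=> [eps [d [[MB WU] bipU [d0 symU] connW isoF]]] vU iW Biv uniq_i.
have iU : i \in U by apply: (subsetP WU).
have iv : i != v by apply: contraNneq vU => <-.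
have Bv0 x : x \in U -> x != i -> B x v = 0.
  move=> xU xi; case: (boolP (x \in W)) => xW; first exact: uniq_i.
  by apply: isoF; rewrite inE ?xW // (negPf vU) andbF.
have sssB := M_sss MB.
have vB0 x : x \in U -> x != i -> B v x = 0.
  by move=> xU xi; apply/eqP; rewrite sss_eq0 // Bv0.
have FE : (v |: U) :\: (v |: W) = U :\: W.
  apply/setP => x; rewrite !inE; case: (eqVneq x v) => [->|] //=.
  by rewrite (negPf vU) andbF.
have vF : v \notin U :\: W by rewrite inE (negPf vU) andbF.
have [B' [MB' B'U B'v B'i isoF']] : exists B', [/\ M B',
    {in U &, forall x y, B' x y = B x y},
    forall x, x \in U -> `|B' x v| = `|B x v| /\ `|B' v x| = `|B v x|,
    if eps i then 0 < B' i v else B' i v < 0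
  & forall x y, x \in U :\: W -> y \notin U :\: W -> B' x y = 0].
  have [good|bad] := boolP (if eps i then 0 < B i v else B i v < 0).
    by exists B; split.
  exists (matrix_mutation B v); split.
  - exact: M_mutation.
  - move=> x y xU yU.
    have xv : x != v by apply: contraNneq vU => <-.
    have yv : y != v by apply: contraNneq vU => <-.
    rewrite matrix_mutationE //.
    have [->|xi] := eqVneq x i; last by rewrite Bv0 // !lexx !mul0r !addr0 !if_same.
    have [->|yi] := eqVneq y i; last by rewrite vB0 // !lexx !mulr0 !addr0 !if_same.
    case: (ltrgtP (B i v) 0) Biv => // p _ /=.
      by have q : 0 < B v i; [rewrite sss_gt0|rewrite (lt_geF q)].
    by have q : B v i < 0; [rewrite -sss_gt0|rewrite (lt_geF q)].
  - by move=> x xU; rewrite /matrix_mutation eqxx orbT /= !normrN.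
  - move: bad; rewrite /matrix_mutation eqxx orbT /= oppr_gt0 oppr_lt0.
    by case: ifP => _; case: (ltrgtP (B i v) 0) Biv.
  - move=> x y xF yF; have := @mutation_sequence_isolated B (U :\: W) [:: v] MB isoF.
    move=> /(_ _ x y)/=; rewrite xF => -> //; first exact: isoF.
    by move=> z; rewrite inE => /eqP->.
have sssB' := M_sss MB'.
have B'v0 x : x \in U -> x != i -> B' x v = 0.
  move=> xU xi; apply/eqP; have [+ _] := B'v x xU.
  by rewrite Bv0 // normr0 => /eqP; rewrite normr_eq0.
have B'iv : B' i v != 0.
  by have [+ _] := B'v i iU; rewrite -normr_eq0 => ->; rewrite normr_eq0.
have nU x : x \in U -> (x == v) = false.
  by move=> xU; apply: contraNF vU => /eqP<-.
exists B', (fun x => if x == v then ~~ eps i else eps x).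
exists (fun x => if x == v then d i * `|B' i v| else d x * `|B' v i|).
have B'vi : B' v i != 0 by rewrite sss_eq0.
split.
- by split=> //; apply: setUS.
- move=> x y; rewrite !inE => /predU1P[->|xU] /predU1P[->|yU].
  + by rewrite sss_diag // ltxx.
  + rewrite eqxx nU // sss_gt0 //.
    have [->|yi] := eqVneq y i; last by rewrite B'v0 // ltxx.
    by move: B'i; case: ifP => //= _; case: ltrgtP.
  + rewrite eqxx nU //.
    have [->|xi] := eqVneq x i; last by rewrite B'v0 // ltxx.
    by move: B'i; case: ifP => //= _; case: ltrgtP.
  + by rewrite !nU // B'U //; apply: bipU.
- split=> [x|x y].
    by case: ifP => _; rewrite mulr_gt0 ?normr_gt0.
  rewrite !inE => /predU1P[->|xU] /predU1P[->|yU] //; rewrite ?eqxx ?nU //.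
  + have [->|yi] := eqVneq y i; first by ring.
    have -> : B' v y = 0 by apply/eqP; rewrite sss_eq0 // B'v0.
    by rewrite (B'v0 y) // normr0 !mulr0.
  + have [->|xi] := eqVneq x i; first by ring.
    have -> : B' v x = 0 by apply/eqP; rewrite sss_eq0 // B'v0.
    by rewrite (B'v0 x) // normr0 !mulr0.
  + rewrite mulrAC [RHS]mulrAC; congr (_ * _); rewrite !B'U //; exact: symU.
- have sub x y : x \in W -> y \in W -> connect (graph_on B' (v |: W)) x y.
    move=> xW yW; have := connW x y xW yW; apply: connect_sub => {xW yW} {}x {}y.
    case/and3P=> xW yW Bxy; apply: connect1.
    by rewrite /graph_on !inE xW yW !orbT /= B'U // (subsetP WU).
  have vi : connect (graph_on B' (v |: W)) v i.
    by apply: connect1; rewrite /graph_on !inE eqxx iW orbT.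
  have iv' : connect (graph_on B' (v |: W)) i v.
    by apply: connect1; rewrite /graph_on !inE eqxx iW orbT.
  move=> x y; rewrite !inE => /predU1P[->|xW] /predU1P[->|yW].
  + exact: connect0.
  + by apply: connect_trans vi _; apply: sub.
  + by apply: connect_trans iv'; apply: sub.
  + exact: sub.
by move=> x y; rewrite FE; apply: isoF'.
Qed.

(** Sweeps of W do not touch the completed components, and reduce to the situation of
    [attach_vertex]. *)
Lemma grow_component B U W v i : grown B U W -> v \notin U -> i \in W ->
  B i v != 0 -> exists B', grown B' (v |: U) (v |: W).
Proof.
move=> [eps [d [[MB WU] bipU [d0 symU] connW isoF]]] vU iW Biv.
have WUs := subsetP WU.
have bipW : bipartite B W eps.
  by move=> x y xW yW; apply: bipU; apply: WUs.
have [u [u0 uB]] := bipartite_weights MB bipW.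
have vW : v \notin W by apply: contra vU; apply: WUs.
have st : sweepable W v u B eps by split=> //; exists i.
have [L [eps1 [LW bip1 abs1 [j [jW Bjv uniq_j]]]]] :=
  unique_neighbour_reachable vW u0 st.
set B1 := mutation_sequence B L in bip1 abs1 Bjv uniq_j.
have LF : {in L, forall k, k \notin U :\: W} by move=> k /LW kW; rewrite inE kW.
have B1F := mutation_sequence_isolated MB isoF LF; rewrite -/B1 in B1F.
have FW x : x \in U -> x \notin W -> x \in U :\: W by move=> xU xW; rewrite inE xU xW.
have sssB := M_sss MB.
have cross x y : x \in U -> y \in W -> x \notin W -> B x y = 0 /\ B y x = 0.
  move=> xU yW xW; have Bxy : B x y = 0 by apply: isoF; [apply: FW|rewrite inE yW].
  by split=> //; apply/eqP; rewrite sss_eq0 // Bxy.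
apply: (@attach_vertex B1 U W v j) => //.
exists (fun x => if x \in W then eps1 x else eps x), d; split.
- by split=> //; apply: M_mutation_sequence.
- move=> x y xU yU; case: (boolP (x \in W)) => xW; case: (boolP (y \in W)) => yW.
  + exact: bip1.
  + by rewrite B1F ?(FW y) ?orbT //; have [_ ->] := cross y x yU xW yW; rewrite ltxx.
  + by rewrite B1F ?(FW x) //; have [-> _] := cross x y xU yW xW; rewrite ltxx.
  + by rewrite B1F ?(FW x) //; apply: bipU.
- split=> // x y xU yU; case: (boolP (x \in W)) => xW; last first.
    by rewrite !B1F ?(FW x) ?orbT //; apply: symU.
  case: (boolP (y \in W)) => yW; last first.
    by rewrite !B1F ?(FW y) ?orbT //; apply: symU.
  by rewrite !abs1 //; apply: symU.
- move=> x y xW yW; have := connW x y xW yW; apply: connect_sub => {xW yW} {}x {}y.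
  case/and3P=> xW yW Bxy; apply: connect1.
  by rewrite /graph_on xW yW -normr_eq0 abs1 // normr_eq0.
by move=> x y xF yF; rewrite B1F ?xF // isoF.
Qed.

(** When no vertex outside U is joined to W, the component W is complete. *)
Lemma start_component B U W v : grown B U W -> v \notin U ->
  (forall x y, x \in W -> y \notin U -> B x y = 0) -> grown B (v |: U) [set v].
Proof.
move=> [eps [d [[MB WU] bipU [d0 symU] connW isoF]]] vU isoW.
have sssB := M_sss MB.
have isoU x y : x \in U -> y \notin U -> B x y = 0.
  move=> xU yU; case: (boolP (x \in W)) => xW; first exact: isoW.
  by apply: isoF; rewrite inE ?xW // (negPf yU) andbF.
have Bv0 x : x \in U -> B x v = 0 by move=> xU; apply: isoU.
have vB0 x : x \in U -> B v x = 0.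
  by move=> xU; apply/eqP; rewrite sss_eq0 // Bv0.
exists eps, d; split.
- by split=> //; rewrite sub1set setU11.
- move=> x y; rewrite !inE => /predU1P[->|xU] /predU1P[->|yU].
  + by rewrite sss_diag // ltxx.
  + by rewrite vB0 // ltxx.
  + by rewrite Bv0 // ltxx.
  + exact: bipU.
- split=> // x y; rewrite !inE => /predU1P[->|xU] /predU1P[->|yU] //.
  + by rewrite vB0 // Bv0 // normr0 !mulr0.
  + by rewrite vB0 // Bv0 // normr0 !mulr0.
  + exact: symU.
- by move=> x y; rewrite !inE => /eqP-> /eqP->; apply: connect0.
move=> x y; rewrite !inE => /andP[xv]; rewrite (negPf xv) /= => xU.
rewrite negb_and negbK => /orP[/eqP->|]; first exact: Bv0.
by rewrite negb_or => /andP[_]; apply: isoU.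
Qed.

(** Grow the treated set until it contains all vertices; the weights then come from
    the growth obstruction for the whole index set. *)
Lemma finite_class_bipartite B0 : M B0 -> exists B eps d u,
  [/\ M B, bipartite B setT eps, symmetrized B setT d, forall i, 0 < u i
    & forall k, \sum_i u i * `|B i k| < 2 * u k].
Proof.
move=> MB0.
have main m : exists B U W, grown B U W /\ ((m <= #|U|)%N \/ U = setT).
  elim: m => [|m [B [U [W [gr [mU|UT]]]]]].
  - exists B0, set0, set0; split; last by left.
    exists xpredT, (fun=> 1); split.
    + by split=> //; apply: sub0set.
    + by move=> x y; rewrite inE.
    + by split=> // x y; rewrite inE.
    + by move=> x y; rewrite inE.
    + by move=> x y; rewrite !inE.
  - have [UT|UnT] := eqVneq U setT; first by exists B, U, W; split=> //; right.
    have /subsetPn[v _ vU] : ~~ (setT \subset U) by rewrite subTset.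
    have cardU w : w \notin U -> (m.+1 <= #|w |: U|)%N.
      by move=> wU; rewrite cardsU1 wU ltnS.
    have [/existsP[w /existsP[i /and3P[wU iW Biw]]]|/existsPn none] :=
      boolP [exists w, [exists i, [&& w \notin U, i \in W & B i w != 0]]].
      have [B' gr'] := grow_component gr wU iW Biw.
      by exists B', (w |: U), (w |: W); split=> //; left; apply: cardU.
    exists B, (v |: U), [set v]; split; last by left; apply: cardU.
    apply: start_component gr vU _ => x y xW yU.
    have /existsPn/(_ x) := none y; rewrite yU xW negbK.
    by move=> /eqP.
  - by exists B, U, W; split=> //; right.
have [B [U [W [gr UT]]]] := main n.
have {}UT : U = setT.
  case: UT => // nU; apply/eqP; rewrite eqEcard subsetT cardsT card_ord.
  exact: nU.
move: gr; rewrite UT => -[eps [d [[MB _] bipU symU _ _]]].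
have [u [u0 uB]] := bipartite_weights MB bipU.
exists B, eps, d, u; split=> // k.
by have := uB k; rewrite inE => /(_ isT); congr (_ < _); apply: eq_bigl => i; rewrite inE.
Qed.

End FiniteMutationClass.

(** * The classification *)

Unset Implicit Arguments.

Theorem theorem1p6 (P : semifieldType) (n : nat) (A : cluster_algebra P n) :
  finite_type A ->
  exists (B : 'M[int]_n) (p : 'I_n -> P * P),
    [/\ sign_skew_symmetric B,
        cartan_finite_type (cartan_counterpart B),
        forall i j k, 0 <= B i j * B i k,
        forall i, oplus (p i).1 (p i).2 = 1%g
      & exists A' : cluster_algebra P n,
          is_cluster_algebra_of A' B p /\ strongly_isomorphic A A'].
Proof.
move=> finA.
have [S0 S0A] := seeds_nonempty A.
pose x0 (i : 'I_n) := (cluster S0 : seq (ca_field A))`_i.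
have lab0 : labelled_seed x0 (fun i j => bentry S0 (x0 i) (x0 j)).
  exists S0; split=> //.
    move=> i j /eqP; rewrite nth_uniq ?fset_uniq ?seed_card ?ltn_ord // => /eqP; exact: val_inj.
  apply/fsetP => y; apply/idP/imfsetP => [yS|[i _ ->]]; last first.
    by apply: mem_nth; rewrite seed_card.
  have iy : (index y (cluster S0 : seq (ca_field A)) < n)%N.
    by rewrite -[X in (_ < X)%N](seed_card S0) index_mem.
  by exists (Ordinal iy) => //; rewrite /x0 nth_index.
pose M B := exists x, @labelled_seed P n A x B.
have M_mut B k : M B -> M (matrix_mutation B k).
  by case=> x lab; have [x' [_ [_ [lab' _ _]]]] := labelled_seed_mutation k lab; exists x'.
have M_sss B : M B -> sign_skew_symmetric B by case=> x /labelled_seed_sss.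
have [|B [eps [d [u [MB bip [d0 symB] u0 uB]]]]] :=
  @finite_class_bipartite n M M_mut M_sss _ _ (ex_intro _ x0 lab0).
  by move=> B I h eta [x lab]; apply: (growth finA lab).
have sssB := M_sss B MB.
have [x [S [SA x_inj clS BE]]] := MB.
exists (\matrix_(i, j) B i j), (fun i => (pplus S (x i), pminus S (x i))); split.
- by move=> i j; rewrite !mxE.
- apply: (@cartan_counterpart_finite_type n _ d u) => //.
  + by move=> i; rewrite mxE sss_diag.
  + by move=> i j; rewrite !mxE symB.
  + by move=> k; under eq_bigr do rewrite mxE.
- move=> i j k; rewrite !mxE; case: (boolP (eps i)) => ei.
    by rewrite mulr_ge0 // (bipartite_source M_sss MB bip).
  by rewrite mulr_le0 // (bipartite_sink bip).
- by move=> i; apply: seed_normal; rewrite clS; apply: in_imfset.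
exists A; split.
  by exists S => //; exists x; split=> // i j; rewrite mxE BE.
exists idfun; split=> //; first by exists idfun.
exists S0, S0; split=> //; split=> //.
by apply/fsetP => y; apply/idP/imfsetP => [yS|[z zS ->]] //; exists y.
Qed.
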